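(* Let $\Theta=\{(p,q,r)\in[0,1]^3 : p+q+r>0,\ p+q\leqslant 1\}$. There exist $\epsilon_1,\epsilon_2,\epsilon_3\in(0,1)$ such that the following holds. Let $(p,q,r)\in\Theta$ with $p\leqslant\epsilon_1$, $q\leqslant\epsilon_2$, $r\leqslant\epsilon_3$, suppose that $$2(p+q)+6r^{2}+3r(p+2q)\geqslant 4r+(p+q)^{2},$$ and suppose that $(p,q,r)$ satisfies precisely one of the following four sets of constraints: (C1) $p(1-p)\leqslant q\{1-q-r(1-p-q)\}$; (C2) $q\{1-q-r(1-p-q)\}<p(1-p)\leqslant\{q+r(1-p-q)\}\{1-q-r(1-p-q)\}$ and $p-2q+pq+qr-3pr-2p^{2}+3q^{2}\leqslant 0$; (C3) $q\{1-q-r(1-p-q)\}<p(1-p)\leqslant\{q+r(1-p-q)\}\{1-q-r(1-p-q)\}$ and $p-2q+pq+qr-3pr-2p^{2}+3q^{2}>0$ and $p+4q+9pr+5qr+6r^{2}\geqslant 4r+p^{2}+4q^{2}+5pq$; (C4) $q+r(1-p-q)<p$ and $6q+10pr+4qr+p^{2}+6r^{2}\geqslant 4r+6pq+7q^{2}$. Then the probability that the generalized percolation game with parameters $p,q,r$ results in a draw equals $0$.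
   Context: Generalized percolation game with parameters $(p,q,r)$. Consider the directed graph with vertex set $\mathbb{Z}^2$ and directed edges from each $(x,y)$ to $(x+1,y)$ and to $(x,y+1)$. Each vertex is independently labeled trap with probability $p$, target with probability $q$, open with probability $1-p-q$; each directed edge is independently labeled trap with probability $r$ and open with probability $1-r$ (all labels independent). The labels are realized before the game and known to both players. A token is placed at an initial vertex and two players alternately move; a move takes the token from its current vertex $(x,y)$ to $(x+1,y)$ or $(x,y+1)$ along the corresponding directed edge. A player who moves the token along a trap edge loses immediately; otherwise, a player who moves the token (along an open edge) to a trap vertex loses immediately, and one who moves it (along an open edge) to a target vertex wins immediately; if the edge and the vertex reached are both open, the opponent moves next. Convention: if the initial vertex is a trap, the player who is to play first wins; if it is a target, the player who is to play first loses. The game results in a draw if, under optimal play, it continues forever, i.e. neither player has a strategy guaranteeing a win in finitely many moves. The probability of draw (over the random labels) does not depend on the initial vertex. *)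

(* Defs.v *)
From HB Require Import structures.
From mathcomp Require Import all_boot all_order all_algebra finmap.
From mathcomp Require Import all_classical all_reals all_analysis.

Set Implicit Arguments.
Unset Strict Implicit.
Unset Printing Implicit Defensive.

Import Order.TTheory GRing.Theory Num.Theory.

Local Open Scope classical_set_scope.
Local Open Scope ring_scope.

Definition vertex : Type := (int * int)%type.
HB.instance Definition _ := Choice.on vertex.

(* An edge is its tail together with a bit telling whether it is the vertical
   edge (x, y) -> (x, y + 1) or the horizontal edge (x, y) -> (x + 1, y). *)
Definition edge : Type := (vertex * bool)%type.
HB.instance Definition _ := Choice.on edge.

Definition edge_head (e : edge) : vertex :=
  let: ((x, y), up) := e in if up then (x, y + 1) else (x + 1, y).

Inductive vlabel := VTrap | VTarget | VOpen.
Inductive elabel := ETrap | EOpen.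

Definition option_of_vlabel (a : vlabel) : option bool :=
  match a with VTrap => Some false | VTarget => Some true | VOpen => None end.
Definition vlabel_of_option (o : option bool) : vlabel :=
  match o with Some false => VTrap | Some true => VTarget | None => VOpen end.
Lemma option_of_vlabelK : cancel option_of_vlabel vlabel_of_option.
Proof. by case. Qed.

Definition bool_of_elabel (a : elabel) : bool := if a is ETrap then true else false.
Definition elabel_of_bool (b : bool) : elabel := if b then ETrap else EOpen.
Lemma bool_of_elabelK : cancel bool_of_elabel elabel_of_bool.
Proof. by case. Qed.

HB.instance Definition _ := Countable.copy vlabel (can_type option_of_vlabelK).
HB.instance Definition _ := isPointed.Build vlabel VOpen.
HB.instance Definition _ := @isMeasurable.Build default_measure_display
  vlabel discrete_measurable discrete_measurable0
  discrete_measurableC discrete_measurableU.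

HB.instance Definition _ := Countable.copy elabel (can_type bool_of_elabelK).
HB.instance Definition _ := isPointed.Build elabel EOpen.
HB.instance Definition _ := @isMeasurable.Build default_measure_display
  elabel discrete_measurable discrete_measurable0
  discrete_measurableC discrete_measurableU.

Definition mutually_independent (d : measure_display) (T : measurableType d)
    (R : realType) (P : probability T R) (I : choiceType)
    (G : I -> set_system T) : Prop :=
  forall (J : {fset I}) (A : I -> set T), (forall i, i \in J -> G i (A i)) ->
    P (\bigcap_(i in [set` J]) A i) = (\prod_(i <- J) P (A i))%E.

Section labels.
Context (d : measure_display) (T : measurableType d) (R : realType).
Variable P : probability T R.
Variables (V : vertex -> {RV P >-> vlabel}) (E : edge -> {RV P >-> elabel}).

Definition label_sigma_algebra (i : (vertex + edge)%type) : set_system T :=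
  match i with
  | inl v => g_sigma_algebra_preimage (V v)
  | inr e => g_sigma_algebra_preimage (E e)
  end.

Record percolation_labels (p q r : R) : Prop := {
  vertex_trap : forall v, P (V v @^-1` [set VTrap]) = p%:E;
  vertex_target : forall v, P (V v @^-1` [set VTarget]) = q%:E;
  vertex_open : forall v, P (V v @^-1` [set VOpen]) = (1 - p - q)%:E;
  edge_trap : forall e, P (E e @^-1` [set ETrap]) = r%:E;
  edge_open : forall e, P (E e @^-1` [set EOpen]) = (1 - r)%:E;
  labels_independent : mutually_independent P label_sigma_algebra
}.

End labels.

Inductive player := First | Second.

Definition opponent (i : player) : player :=
  match i with First => Second | Second => First end.

Definition mover (n : nat) : player := if odd n then Second else First.

Section game.
(* The realized labels and the initial vertex. *)
Variables (lv : vertex -> vlabel) (le : edge -> elabel) (v0 : vertex).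

(* A play is recorded as an infinite sequence of directions, the n-th of which
   is chosen by [mover n]; the choices made after the first decisive stage are
   irrelevant to the outcome. *)
Fixpoint position (m : nat -> bool) (n : nat) : vertex :=
  if n is n'.+1 then edge_head (position m n', m n') else v0.

(* Winner, if any, when player i has just brought the token to v. *)
Definition arrival (i : player) (v : vertex) : option player :=
  match lv v with
  | VTrap => Some (opponent i)
  | VTarget => Some i
  | VOpen => None
  end.

(* Stage 0 is the check of the initial vertex, with the convention that a trap
   makes the first player win and a target makes it lose, as if the second
   player had just moved there; stage n.+1 is the n-th move. *)
Definition stage (m : nat -> bool) (n : nat) : option player :=
  if n is n'.+1 then
    match le (position m n', m n') with
    | ETrap => Some (opponent (mover n'))
    | EOpen => arrival (mover n') (position m n)
    end
  else arrival Second v0.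

Definition wins (i : player) (m : nat -> bool) : Prop :=
  exists n, stage m n = Some i /\ forall k, (k < n)%N -> stage m k = None.

(* A strategy maps the directions chosen so far (by both players) to the next
   one; it may depend on the labels, which are fixed in this section. *)
Definition consistent (i : player) (s : seq bool -> bool) (m : nat -> bool)
    : Prop :=
  forall n, mover n = i -> m n = s (mkseq m n).

Definition winning_strategy (i : player) (s : seq bool -> bool) : Prop :=
  forall m, consistent i s m -> wins i m.

Definition is_draw : Prop :=
  forall i, ~ exists s, winning_strategy i s.

End game.

Definition draw_event (T : Type) (V : vertex -> T -> vlabel)
    (E : edge -> T -> elabel) (v0 : vertex) : set T :=
  [set w | is_draw (fun v => V v w) (fun e => E e w) v0].

Section constraints.
Context (R : realType).
Variables p q r : R.

Definition Theta : bool :=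
  [&& 0 <= p <= 1, 0 <= q <= 1, 0 <= r <= 1, 0 < p + q + r & p + q <= 1].

Definition C1 : bool := p * (1 - p) <= q * (1 - q - r * (1 - p - q)).

Definition C2 : bool :=
  (q * (1 - q - r * (1 - p - q)) < p * (1 - p)
     <= (q + r * (1 - p - q)) * (1 - q - r * (1 - p - q)))
  && (p - 2 * q + p * q + q * r - 3 * p * r - 2 * p ^+ 2 + 3 * q ^+ 2 <= 0).

Definition C3 : bool :=
  [&& q * (1 - q - r * (1 - p - q)) < p * (1 - p)
        <= (q + r * (1 - p - q)) * (1 - q - r * (1 - p - q)),
      0 < p - 2 * q + p * q + q * r - 3 * p * r - 2 * p ^+ 2 + 3 * q ^+ 2
    & 4 * r + p ^+ 2 + 4 * q ^+ 2 + 5 * p * q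
        <= p + 4 * q + 9 * p * r + 5 * q * r + 6 * r ^+ 2].

Definition C4 : bool :=
  (q + r * (1 - p - q) < p)
  && (4 * r + 6 * p * q + 7 * q ^+ 2
        <= 6 * q + 10 * p * r + 4 * q * r + p ^+ 2 + 6 * r ^+ 2).

End constraints.

(* Main.v *)
Require Import Defs.
From HB Require Import structures.
From mathcomp Require Import all_boot all_order all_algebra finmap.
From mathcomp Require Import all_classical all_reals all_analysis.
From mathcomp Require Import ring lra zify.

(** Give every site a status: [Win] or [Loss] if the player about to move from
    it can force a win or is forced to lose within [n] moves, and [Draw]
    otherwise. With look-ahead [n + 1], the statuses along a diagonal are
    obtained from those with look-ahead [n] along the next diagonal by a
    probabilistic cellular automaton with independent local updates, and
    initially every site is [Draw].

    The probability that a site is [Draw] is controlled by a potential, a sum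
    of probabilities of patterns containing [Draw]. To leading order, up to a
    factor 8 and writing D, W, L for the probabilities of patterns read along
    the diagonal, it is
      [D + (1 + p/2) DW + DWL + (3r - 3p/2) DL].
    Each step decreases it by at least a multiple of [(q + p^2) D], provided
    that [r <= 7/4 q + 1/3 p^2] and that [p], [q], [r] are small. As the
    potential is bounded, the probabilities of [Draw] are summable over [n], so
    their limit, the probability of a draw, vanishes. Each of the conditions
    (C1)-(C4), together with the common constraint, implies that bound on [r].
*)

Set Implicit Arguments.
Unset Strict Implicit.
Unset Printing Implicit Defensive.

Import Order.TTheory GRing.Theory Num.Theory.

Local Open Scope classical_set_scope.
Local Open Scope ring_scope.

(** * Local dynamics and the certificate *)

Inductive status := Win | Loss | Draw.

Definition option_of_status (a : status) : option bool :=
  match a with Win => Some true | Loss => Some false | Draw => None end.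
Definition status_of_option (o : option bool) : status :=
  match o with Some true => Win | Some false => Loss | None => Draw end.
Lemma option_of_statusK : cancel option_of_status status_of_option.
Proof. by case. Qed.
HB.instance Definition _ := Countable.copy status (can_type option_of_statusK).

Definition statuses : seq status := [:: Win; Loss; Draw].

(** Crossing a trap edge loses at once, exactly like handing the opponent a winning site, so such an
    edge counts as leading to a [Win]. *)
Definition through (e : elabel) (a : status) : status :=
  if e is ETrap then Win else a.

(** Statuses take the viewpoint of the player about to move: the opponent, having just arrived, has
    lost at a trap and won at a target. This matches the convention for the initial vertex. *)
Definition update (l : vlabel) (e e' : elabel) (a b : status) : status :=
  match l with
  | VTrap => Win
  | VTarget => Loss
  | VOpen =>
      match through e a, through e' b with
      | Loss, _ | _, Loss => Win
      | Win, Win => Loss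
      | _, _ => Draw
      end
  end.

(** Polynomials in p, q, r as syntax: the certificate is checked by integer computation on the
    syntax, and [peval] carries it over to the reals. *)
Inductive pexpr :=
  | Pp | Pq | Pr | Pint of int | Padd of pexpr & pexpr | Pmul of pexpr & pexpr.

Definition vweight (l : vlabel) : pexpr :=
  match l with
  | VTrap => Pp
  | VTarget => Pq
  | VOpen => Padd (Pint 1) (Pmul (Pint (-1)) (Padd Pp Pq))
  end.

Definition eweight (e : elabel) : pexpr :=
  match e with ETrap => Pr | EOpen => Padd (Pint 1) (Pmul (Pint (-1)) Pr) end.

Definition labels : seq (vlabel * elabel * elabel) :=
  [seq (x, e) | x <- [seq (l, e) | l <- [:: VTrap; VTarget; VOpen],
                                   e <- [:: ETrap; EOpen]],
                e <- [:: ETrap; EOpen]].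

Definition psum {T : Type} (s : seq T) (f : T -> pexpr) : pexpr :=
  foldr (fun x e => Padd (f x) e) (Pint 0) s.

Definition transitionx (a b c : status) : pexpr :=
  psum [seq x <- labels | update x.1.1 x.1.2 x.2 a b == c]
    (fun x => Pmul (vweight x.1.1) (Pmul (eweight x.1.2) (eweight x.2))).

Definition linx (c0 cp cr : int) : pexpr :=
  Padd (Pint c0) (Padd (Pmul (Pint cp) Pp) (Pmul (Pint cr) Pr)).

(* Found by linear programming. The potential of a row is the sum over its
   windows [abc] of [potential a b c + potential c b a]; the asymmetric part of
   the table is a coboundary, which makes the decrease of the potential
   nonnegative on each window of four sites separately. *)
Definition potentialx (a b c : status) : pexpr :=
  match a, b, c with
  | Draw, Draw, Draw => linx 4 0 0
  | Draw, Draw, Loss => linx 2 (-2) 6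
  | Draw, Draw, Win => linx 2 1 4
  | Draw, Loss, Draw => linx 4 (-3) 6
  | Draw, Loss, Loss => linx 0 0 6
  | Draw, Loss, Win => linx 0 0 10
  | Draw, Win, Draw => linx 6 1 0
  | Draw, Win, Loss => linx 6 1 0
  | Draw, Win, Win => linx 4 (-1) 0
  | Loss, Draw, Draw => linx 2 (-1) 0
  | Loss, Draw, Loss => linx 0 (-3) 6
  | Loss, Draw, Win => linx 0 (-2) 6
  | Loss, Loss, Draw => linx 4 (-3) 0
  | Loss, Win, Draw => linx 4 0 0
  | Win, Draw, Draw => linx 4 0 (-4)
  | Win, Draw, Loss => linx 2 0 0
  | Win, Draw, Win => linx 2 1 0
  | Win, Loss, Draw => linx 4 (-3) (-4)
  | Win, Win, Draw => linx 2 2 0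
  | _, _, _ => Pint 0
  end.

(* The expected decrease of the potential in one step on a window [abcd]. *)
Definition slackx (a b c d : status) : pexpr :=
  Padd (Padd (potentialx a b c) (potentialx d c b))
    (Pmul (Pint (-1))
       (psum statuses (fun a' => psum statuses (fun b' => psum statuses (fun c' =>
          Pmul (Pmul (transitionx a b a') (Pmul (transitionx b c b') (transitionx c d c')))
            (Padd (potentialx a' b' c') (potentialx c' b' a'))))))).

(* The quotient of Z[p, q, r] by [pq, pr, q^2, qr, r^2, p^3]: these monomials
   are negligible with respect to [q + r + p^2]. *)
Record jet := Jet { j0 : int; jp : int; jq : int; jr : int; jpp : int }.

Definition jadd (x y : jet) : jet :=
  Jet (j0 x + j0 y) (jp x + jp y) (jq x + jq y) (jr x + jr y) (jpp x + jpp y).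

Definition jmul (x y : jet) : jet :=
  Jet (j0 x * j0 y) (j0 x * jp y + jp x * j0 y) (j0 x * jq y + jq x * j0 y)
    (j0 x * jr y + jr x * j0 y) (j0 x * jpp y + jp x * jp y + jpp x * j0 y).

Fixpoint jet_of (e : pexpr) : jet :=
  match e with
  | Pp => Jet 0 1 0 0 0
  | Pq => Jet 0 0 1 0 0
  | Pr => Jet 0 0 0 1 0
  | Pint n => Jet n 0 0 0 0
  | Padd e e' => jadd (jet_of e) (jet_of e')
  | Pmul e e' => jmul (jet_of e) (jet_of e')
  end.

(* A sufficient condition for nonnegativity when [r <= 7/4 q + 1/3 p^2] and
   [p], [q], [r] are at most 1/1000; that constraint is the source of the two
   combinations with [jr]. *)
Definition jet_nonneg (x : jet) : bool :=
  [&& (-100 <= jp x), (-100 <= jq x), (-100 <= jr x) & (-100 <= jpp x)] &&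
  ((0 < j0 x) ||
   [&& j0 x == 0, 0 <= jq x, 0 <= 4 * jq x + 7 * jr x
     & (0 < jp x) || [&& jp x == 0, 0 <= jpp x & 0 <= 3 * jpp x + jr x]]).

(** The gain is charged to the second site of the window only, so averaging over windows yields q +
    p^2 times the probability of a [Draw]. The actual target is a quarter of it; [certx] clears that
    denominator. *)
Definition gainx (b : status) : pexpr :=
  if b is Draw then Padd Pq (Pmul Pp Pp) else Pint 0.

Definition certx (a b c d : status) : pexpr :=
  Padd (Pmul (Pint 4) (slackx a b c d)) (Pmul (Pint (-1)) (gainx b)).

(** There are only 81 windows; the jet of each is computed over the integers and tested. *)
Lemma cert_nonneg (a b c d : status) : jet_nonneg (jet_of (certx a b c d)).
Proof.
by case: a; case: b; case: c; case: d; vm_compute.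
Qed.

(** * Truncated expansions in p, q, r *)

Section evaluation.
Context {R : realType}.
Variables p q r : R.

Fixpoint peval (e : pexpr) : R :=
  match e with
  | Pp => p
  | Pq => q
  | Pr => r
  | Pint n => n%:~R
  | Padd e e' => peval e + peval e'
  | Pmul e e' => peval e * peval e'
  end.

Definition jeval (x : jet) : R :=
  (j0 x)%:~R + (jp x)%:~R * p + (jq x)%:~R * q + (jr x)%:~R * r
  + (jpp x)%:~R * p ^+ 2.

(** One quantity bounds the value of an expression, the norm of its jet and the constant in its
    truncation error. The 5 for products is 1 + 1 for the errors of the two factors plus 3 for
    truncating the product of their jets. *)
Fixpoint pbound (e : pexpr) : R :=
  match e with
  | Pp | Pq | Pr => 1
  | Pint n => `|n%:~R|
  | Padd e e' => pbound e + pbound e'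
  | Pmul e e' => 5 * (pbound e * pbound e')
  end.

Definition jet_norm (x : jet) : R :=
  `|(j0 x)%:~R| + `|(jp x)%:~R| + `|(jq x)%:~R| + `|(jr x)%:~R| + `|(jpp x)%:~R|.

(** Every monomial killed in the jet quotient is at most [(p + q + r) * small]. *)
Definition small : R := q + r + p ^+ 2.

Lemma peval_psum (T : Type) (s : seq T) (f : T -> pexpr) :
  peval (psum s f) = \sum_(x <- s) peval (f x).
Proof. by elim: s => [|x s IHs] /=; rewrite ?big_nil // big_cons IHs. Qed.

Lemma pbound_ge0 (e : pexpr) : 0 <= pbound e.
Proof.
elim: e => //= [e He e' He'|e He e' He'].
- by rewrite addr_ge0.
- by rewrite !mulr_ge0.
Qed.

Lemma jet_norm_add (x y : jet) : jet_norm (jadd x y) <= jet_norm x + jet_norm y.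
Proof.
have n (a b : int) : `|(a + b)%:~R| <= `|a%:~R| + `|b%:~R| :> R.
  by rewrite rmorphD ler_normD.
rewrite /jet_norm /=.
have := n (j0 x) (j0 y); have := n (jp x) (jp y); have := n (jq x) (jq y).
have := n (jr x) (jr y); have := n (jpp x) (jpp y).
lra.
Qed.

Lemma jet_norm_mul (x y : jet) : jet_norm (jmul x y) <= jet_norm x * jet_norm y.
Proof.
have n (a b c d : int) :
    `|(a * b + c * d)%:~R| <= `|a%:~R| * `|b%:~R| + `|c%:~R| * `|d%:~R| :> R.
  by rewrite rmorphD !rmorphM /= -!normrM ler_normD.
have n0 : `|(j0 x * j0 y)%:~R| <= `|(j0 x)%:~R| * `|(j0 y)%:~R| :> R.
  by rewrite rmorphM normrM.
have npp : `|(j0 x * jpp y + jp x * jp y + jpp x * j0 y)%:~R|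
    <= `|(j0 x)%:~R| * `|(jpp y)%:~R| + `|(jp x)%:~R| * `|(jp y)%:~R|
       + `|(jpp x)%:~R| * `|(j0 y)%:~R| :> R.
  rewrite 2!rmorphD !rmorphM /= -!normrM.
  by apply: le_trans (ler_normD _ _) (lerD (ler_normD _ _) _).
have np := n (j0 x) (jp y) (jp x) (j0 y).
have nq := n (j0 x) (jq y) (jq x) (j0 y).
have nr := n (j0 x) (jr y) (jr x) (j0 y).
apply: le_trans (lerD (lerD (lerD (lerD n0 np) nq) nr) npp) _.
rewrite /jet_norm.
move: (normr_ge0 ((j0 x)%:~R : R)); move: `|(j0 x)%:~R| => a0 a00.
move: (normr_ge0 ((j0 y)%:~R : R)); move: `|(j0 y)%:~R| => b0 b00.
move: (normr_ge0 ((jp x)%:~R : R)); move: `|(jp x)%:~R| => ap ap0.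
move: (normr_ge0 ((jp y)%:~R : R)); move: `|(jp y)%:~R| => bp bp0.
move: (normr_ge0 ((jq x)%:~R : R)); move: `|(jq x)%:~R| => aq aq0.
move: (normr_ge0 ((jq y)%:~R : R)); move: `|(jq y)%:~R| => bq bq0.
move: (normr_ge0 ((jr x)%:~R : R)); move: `|(jr x)%:~R| => ar ar0.
move: (normr_ge0 ((jr y)%:~R : R)); move: `|(jr y)%:~R| => br br0.
move: (normr_ge0 ((jpp x)%:~R : R)); move: `|(jpp x)%:~R| => app app0.
move: (normr_ge0 ((jpp y)%:~R : R)); move: `|(jpp y)%:~R| => bpp bpp0.
rewrite -subr_ge0.
(* [t] consists of the products of norms dropped by the truncation: all pairs of non-constant
   coefficients except p times p. *)
set t := (X in 0 <= X).
have -> : t = (ap + aq + ar + app) * (bq + br + bpp)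
              + (aq + ar + app) * bp by rewrite /t; ring.
by rewrite addr_ge0 // mulr_ge0 // !addr_ge0.
Qed.

Hypothesis cube : [/\ 0 <= p <= 1, 0 <= q <= 1 & 0 <= r <= 1].

Lemma jet_of_norm (e : pexpr) : jet_norm (jet_of e) <= pbound e.
Proof.
pose z := (mulr0z, mulr1z, normr0, normr1, add0r, addr0).
elim: e => /=; rewrite ?/jet_norm /= ?z //.
- by move=> n; rewrite !z.
- by move=> e He e' He'; apply: le_trans (jet_norm_add _ _) (lerD He He').
- move=> e He e' He'; apply: le_trans (jet_norm_mul _ _) _.
  have := ler_pM (_ : 0 <= _) (_ : 0 <= _) He He'.
  have nn x : 0 <= jet_norm x by rewrite /jet_norm !addr_ge0.
  move=> /(_ (nn _) (nn _)) h; apply: le_trans h _.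
  by rewrite ler_peMl // ?mulr_ge0 ?pbound_ge0 // ler1n.
Qed.

Lemma small_ge0 : 0 <= small.
Proof.
have [/andP[p0 p1] /andP[q0 q1] /andP[r0 r1]] := cube.
by rewrite /small !addr_ge0 ?sqr_ge0. Qed.

Lemma small_le : small <= p + q + r.
Proof.
have [/andP[p0 p1] /andP[q0 q1] /andP[r0 r1]] := cube.
by have := ler_piMr p0 p1; rewrite /small expr2; lra. Qed.

Lemma jet_norm_ge0 (x : jet) : 0 <= jet_norm x.
Proof. by rewrite /jet_norm !addr_ge0. Qed.

Lemma norm_jeval (x : jet) : `|jeval x| <= jet_norm x.
Proof.
have [/andP[p0 p1] /andP[q0 q1] /andP[r0 r1]] := cube.
have le1 (n : int) (t : R) : 0 <= t <= 1 -> `|n%:~R * t| <= `|n%:~R|.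
  move=> /andP[t0 t1]; rewrite normrM (ger0_norm t0).
  by rewrite ler_piMr.
have p2 : 0 <= p ^+ 2 <= 1 by rewrite sqr_ge0 expr_le1.
rewrite /jeval /jet_norm.
do 4?[apply: le_trans (ler_normD _ _) _; apply: lerD; last by apply: le1 => //; apply/andP].
by [].
Qed.

(** Split each jet into its constant, its p-term and a part [high] in q, r, p^2, which is of size
    [small]. The dropped products are p-term times [high], twice, and [high] times [high]; since
    [small <= p + q + r], they total at most 3 units. *)
Lemma jmul_error (x y : jet) :
  `|jeval x * jeval y - jeval (jmul x y)|
    <= 3 * (jet_norm x * jet_norm y) * ((p + q + r) * small).
Proof.
have [/andP[p0 p1] /andP[q0 q1] /andP[r0 r1]] := cube.
have sm0 := small_ge0; have sm1 := small_le.
pose high (z : jet) : R :=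
  (jq z)%:~R * q + (jr z)%:~R * r + (jpp z)%:~R * p ^+ 2.
have high_le z : `|high z| <= jet_norm z * small.
  have le1 (n : int) (t : R) : 0 <= t -> t <= small ->
      `|n%:~R * t| <= `|n%:~R| * small.
    by move=> t0 t1; rewrite normrM (ger0_norm t0) ler_wpM2l.
  have p2 := sqr_ge0 p.
  apply: (@le_trans _ _ (`|(jq z)%:~R| * small + `|(jr z)%:~R| * small
                         + `|(jpp z)%:~R| * small)).
    do 2?[apply: le_trans (ler_normD _ _) _; apply: lerD];
      by apply: le1; rewrite /small; lra.
  rewrite -!mulrDl ler_wpM2r // /jet_norm.
  have n0 (n : int) : 0 <= `|n%:~R| :> R by exact: normr_ge0.
  have := n0 (j0 z); have := n0 (jp z); lra.
have jp_le z : `|(jp z)%:~R * p| <= jet_norm z * p.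
  rewrite normrM (@ger0_norm _ p); last by lra.
  rewrite ler_wpM2r //.
  rewrite /jet_norm.
  have n0 (n : int) : 0 <= `|n%:~R| :> R by exact: normr_ge0.
  have := n0 (j0 z); have := n0 (jq z); have := n0 (jr z); have := n0 (jpp z).
  lra.
have -> : jeval x * jeval y - jeval (jmul x y) =
    (jp x)%:~R * p * high y + high x * ((jp y)%:~R * p) + high x * high y.
  by rewrite /jeval /high /= !rmorphD /= !rmorphM /=; ring.
have nx := jet_norm_ge0 x; have ny := jet_norm_ge0 y.
apply: (@le_trans _ _ (jet_norm x * p * (jet_norm y * small)
   + jet_norm x * small * (jet_norm y * p)
   + jet_norm x * small * (jet_norm y * small))).
  by do 2?[apply: le_trans (ler_normD _ _) _; apply: lerD];
    rewrite normrM; apply: ler_pM.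
have nn := mulr_ge0 nx ny.
have -> : jet_norm x * p * (jet_norm y * small)
   + jet_norm x * small * (jet_norm y * p)
   + jet_norm x * small * (jet_norm y * small) =
   (jet_norm x * jet_norm y) * ((2 * p + small) * small) by ring.
have -> : 3 * (jet_norm x * jet_norm y) * ((p + q + r) * small) =
   (jet_norm x * jet_norm y) * ((3 * (p + q + r)) * small) by ring.
by apply: ler_wpM2l => //; apply: ler_wpM2r => //; lra.
Qed.

Lemma norm_peval (e : pexpr) : `|peval e| <= pbound e.
Proof.
have [/andP[p0 p1] /andP[q0 q1] /andP[r0 r1]] := cube.
elim: e => //=.
- by rewrite ger0_norm; lra.
- by rewrite ger0_norm; lra.
- by rewrite ger0_norm; lra.
- by move=> e He e' He'; apply: le_trans (ler_normD _ _) (lerD He He').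
- move=> e He e' He'; rewrite normrM.
  apply: le_trans (ler_pM _ _ He He') _ => //.
  by rewrite ler_peMl // ?mulr_ge0 ?pbound_ge0 // ler1n.
Qed.

(** Induction on the expression. Only products create new error; there it telescopes through the two
    factors before the truncation is paid for. *)
Lemma jet_of_error (e : pexpr) :
  `|peval e - jeval (jet_of e)| <= pbound e * ((p + q + r) * small).
Proof.
have [/andP[p0 p1] /andP[q0 q1] /andP[r0 r1]] := cube.
have e0 : 0 <= (p + q + r) * small by rewrite mulr_ge0 ?small_ge0 //; lra.
pose z := (mulr0z, mulr1z, mul0r, mul1r, addr0, add0r, subrr, normr0).
elim: e => /=.
- by rewrite /jeval /= !z.
- by rewrite /jeval /= !z.
- by rewrite /jeval /= !z.
- by move=> n; rewrite /jeval /= !z mulr_ge0.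
- move=> e He e' He'.
  have -> : jeval (jadd (jet_of e) (jet_of e')) =
      jeval (jet_of e) + jeval (jet_of e').
    by rewrite /jeval /= !rmorphD /=; ring.
  by rewrite opprD addrACA mulrDl; apply: le_trans (ler_normD _ _) (lerD He He').
- move=> e He e' He'.
  set x := jet_of e; set y := jet_of e'.
  have -> : peval e * peval e' - jeval (jmul x y) =
      (peval e - jeval x) * peval e' + jeval x * (peval e' - jeval y)
      + (jeval x * jeval y - jeval (jmul x y)) by ring.
  set t := _ * small in He He' e0 *.
  have b := pbound_ge0 e; have b' := pbound_ge0 e'.
  have -> : 5 * (pbound e * pbound e') * t =
      pbound e * t * pbound e' + pbound e * (pbound e' * t)
      + 3 * (pbound e * pbound e') * t by ring.
  apply: le_trans (ler_normD _ _) (lerD _ _); last first.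
    apply: le_trans (jmul_error _ _) _; rewrite ler_wpM2r //.
    by rewrite ler_wpM2l // ler_pM ?jet_norm_ge0 ?jet_of_norm.
  apply: le_trans (ler_normD _ _) (lerD _ _); rewrite normrM.
    by apply: ler_pM => //; exact: norm_peval.
  by apply: ler_pM => //; apply: le_trans (norm_jeval _) (jet_of_norm _).
Qed.

(** The lowest-order nonzero coefficient dominates. A negative coefficient of r is worst when r
    attains its upper bound; substituting that bound leaves the combinations [4 * jq + 7 * jr] and
    [3 * jpp + jr] as coefficients of q and p^2. *)
Lemma jet_nonneg_jeval (x : jet) : p <= 1 / 1000 -> q <= 1 / 1000 ->
  r <= 1 / 1000 -> r <= 7 / 4 * q + 1 / 3 * p ^+ 2 ->
  jet_nonneg x -> 0 <= jeval x.
Proof.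
have [/andP[p0 p1] /andP[q0 q1] /andP[r0 r1]] := cube.
move=> ps qs rs rle /andP[/and4P[hp hq hr hpp] hx].
have intz (m n : int) : m <= n -> m%:~R <= n%:~R :> R by rewrite ler_int.
have pp0 : 0 <= p ^+ 2 by exact: sqr_ge0.
have pps : p ^+ 2 <= 1 / 1000 * p by rewrite expr2 ler_wpM2r.
move: hp hq hr hpp => /intz hp /intz hq /intz hr /intz hpp.
have := ler_wpM2r p0 hp; have := ler_wpM2r q0 hq.
have := ler_wpM2r r0 hr; have := ler_wpM2r pp0 hpp.
rewrite /jeval => Hpp Hr Hq Hp.
case/orP: hx => [x0|/and4P[/eqP x0 xq xqr hx]].
  (* A constant of at least 1 beats the other terms, each of which is at least -1/10. *)
  by have /intz := (x0 : 1 <= j0 x); lra.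
rewrite x0 add0r.
have high0 : 0 <= 3 * jpp x + jr x -> 0 <= jpp x ->
    0 <= (jq x)%:~R * q + (jr x)%:~R * r + (jpp x)%:~R * p ^+ 2.
  move=> /intz; rewrite rmorphD rmorphM /= => h3 /intz h4.
  move: xq xqr => /intz xq /intz; rewrite rmorphD !rmorphM /= => xqr.
  have [r_ge0|r_lt0] := leP 0 ((jr x)%:~R : R).
    by rewrite !addr_ge0 // mulr_ge0.
  have h5 : (jr x)%:~R * (7 / 4 * q + 1 / 3 * p ^+ 2) <= (jr x)%:~R * r.
    by rewrite ler_nM2l.
  have h6 := mulr_ge0 pp0 h3.
  have h7 := mulr_ge0 q0 xqr.
  lra.
case/orP: hx => [xp|/and3P[/eqP xp xpp xppr]].
  have /intz := (xp : 1 <= jp x) => xp1.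
  have := ler_wpM2r p0 xp1.
  (* 34 exceeds 100/3, the largest cost in p^2 of a negative r-term. With the p^2-term itself this
     costs at most 134 p^2, which the p-term covers. *)
  have : 0 <= (jq x)%:~R * q + (jr x)%:~R * r + 34%:~R * p ^+ 2.
    move: xq xqr => /intz xq /intz; rewrite rmorphD !rmorphM /= => xqr.
    have [r_ge0|r_lt0] := leP 0 ((jr x)%:~R : R).
      by rewrite !addr_ge0 // mulr_ge0.
    have h5 : (jr x)%:~R * (7 / 4 * q + 1 / 3 * p ^+ 2) <= (jr x)%:~R * r.
      by rewrite ler_nM2l.
    have h7 := mulr_ge0 q0 xqr.
    have h8 : 0 <= p ^+ 2 * ((jr x)%:~R - (-100)%:~R) by rewrite mulr_ge0 // subr_ge0.
    lra.
  lra.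
by rewrite xp mul0r add0r; exact: high0.
Qed.
End evaluation.

(** * Decrease of the potential *)

Section drift.
Context {R : realType}.
Variables p q r : R.

Definition transition (a b c : status) : R := peval p q r (transitionx a b c).
Definition potential (a b c : status) : R := peval p q r (potentialx a b c).
Definition slack (a b c d : status) : R := peval p q r (slackx a b c d).

Lemma transitionE (a b c : status) : transition a b c =
  \sum_(x <- labels | update x.1.1 x.1.2 x.2 a b == c)
    peval p q r (vweight x.1.1)
      * (peval p q r (eweight x.1.2) * peval p q r (eweight x.2)).
Proof. by rewrite /transition peval_psum big_filter. Qed.

Lemma slackE (a b c d : status) : slack a b c d =
  potential a b c + potential d c b -
  \sum_(a' <- statuses) \sum_(b' <- statuses) \sum_(c' <- statuses)
    transition a b a' * (transition b c b' * transition c d c')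
    * (potential a' b' c' + potential c' b' a').
Proof.
pose kk a' b' c' := Pmul
  (Pmul (transitionx a b a') (Pmul (transitionx b c b') (transitionx c d c')))
  (Padd (potentialx a' b' c') (potentialx c' b' a')).
have -> : slack a b c d = potential a b c + potential d c b
    + (-1)%:~R * peval p q r (psum statuses (fun a' =>
        psum statuses (fun b' => psum statuses (kk a' b')))) by [].
rewrite mulN1r peval_psum; congr (_ - _).
apply: eq_bigr => a' _; rewrite peval_psum.
by apply: eq_bigr => b' _; rewrite peval_psum.
Qed.

Lemma certE (a b c d : status) : peval p q r (certx a b c d) =
  4 * slack a b c d - (b == Draw)%:R * (q + p ^+ 2).
Proof.
have -> : peval p q r (certx a b c d) = 4%:~R * slack a b c d
    + (-1)%:~R * peval p q r (gainx b) by [].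
rewrite mulN1r mulrz_nat; congr (_ - _).
by case: b => /=; rewrite ?mul0r // mul1r expr2.
Qed.

Lemma update_neq_draw (l : vlabel) (e e' : elabel) (a b : status) :
  a != Draw -> b != Draw -> update l e e' a b != Draw.
Proof. by case: l; case: e; case: e'; case: a; case: b. Qed.

Lemma transition_draw (a b : status) : a != Draw -> b != Draw -> transition a b Draw = 0.
Proof.
move=> aD bD; rewrite transitionE big1 // => x /eqP xD.
by have := update_neq_draw x.1.1 x.1.2 x.2 aD bD; rewrite xD.
Qed.

Lemma potential_no_draw (a b c : status) :
  a != Draw -> b != Draw -> c != Draw -> potential a b c = 0.
Proof. by case: a; case: b; case: c. Qed.

(** Two decided successors give a decided site, so a window without [Draw] produces none. The slack
    must vanish exactly here, as there is no [Draw] to which a truncation error could be charged. *)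
Lemma slack_no_draw (a b c d : status) :
  a != Draw -> b != Draw -> c != Draw -> d != Draw -> slack a b c d = 0.
Proof.
move=> aD bD cD dD; rewrite slackE !potential_no_draw // addr0 sub0r.
apply/eqP; rewrite oppr_eq0; apply/eqP.
apply: big1 => a' _; apply: big1 => b' _; apply: big1 => c' _.
have [->|a'D] := eqVneq a' Draw; first by rewrite transition_draw // !mul0r.
have [->|b'D] := eqVneq b' Draw; first by rewrite (transition_draw bD) // mul0r mulr0 mul0r.
have [->|c'D] := eqVneq c' Draw; first by rewrite (transition_draw cD) // !mulr0 mul0r.
by rewrite !potential_no_draw // addr0 mulr0.
Qed.

End drift.

Lemma le_sum_status {R : realType} (f : status -> R) (a : status) :
  (forall a, 0 <= f a) -> f a <= \sum_(a <- statuses) f a.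
Proof.
move=> f0; rewrite !big_cons big_nil addr0.
have := f0 Win; have := f0 Loss; have := f0 Draw; case: a; lra.
Qed.

(** The sum over all windows serves as the bound. Its numerical value is immaterial, since the
    threshold [e] is chosen after [C]. *)
Lemma cert_bound {R : realType} :
  exists C : R, 0 <= C /\ forall a b c d, pbound (certx a b c d) <= C.
Proof.
exists (\sum_(a <- statuses) \sum_(b <- statuses) \sum_(c <- statuses)
    \sum_(d <- statuses) pbound (certx a b c d)); split.
  by do 4![apply: sumr_ge0 => ? _]; exact: pbound_ge0.
move=> a b c d.
apply: le_trans (@le_sum_status R (fun a => \sum_(b <- statuses)
  \sum_(c <- statuses) \sum_(d <- statuses) pbound (certx a b c d)) a _);
  last by move=> a'; do 3![apply: sumr_ge0 => ? _]; exact: pbound_ge0.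
apply: le_trans (@le_sum_status R (fun b => \sum_(c <- statuses)
  \sum_(d <- statuses) pbound (certx a b c d)) b _);
  last by move=> b'; do 2![apply: sumr_ge0 => ? _]; exact: pbound_ge0.
apply: le_trans (@le_sum_status R (fun c =>
  \sum_(d <- statuses) pbound (certx a b c d)) c _);
  last by move=> c'; apply: sumr_ge0 => ? _; exact: pbound_ge0.
by apply: (@le_sum_status R (fun d => pbound (certx a b c d))) => d';
  exact: pbound_ge0.
Qed.

Section drift_bound.
Context {R : realType} (C e p q r : R).
Hypothesis C0 : 0 <= C.
Hypothesis pboundC : forall a b c d, pbound (certx a b c d) <= C.
Hypothesis eC : e * (1000 + 72 * C) <= 1.
Hypothesis pqr : [/\ 0 <= p <= e, 0 <= q <= e & 0 <= r <= e].
Hypothesis rle : r <= 7 / 4 * q + 1 / 3 * p ^+ 2.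

(** For [e] this small, the truncation error is at most an eighth of q + p^2, and a window with
    nonzero slack contains a [Draw]. Charging that eighth to every [Draw] of the window therefore
    covers the error. *)
Lemma slack_lower_bound (a b c d : status) :
  (b == Draw)%:R * (q + p ^+ 2)
    - (1 / 2) * (q + p ^+ 2) * ((a == Draw)%:R + (b == Draw)%:R
         + (c == Draw)%:R + (d == Draw)%:R) / 4
  <= 4 * slack p q r a b c d.
Proof.
have [/andP[p0 pR] /andP[q0 qR] /andP[r0 rR]] := pqr.
have e0 := le_trans p0 pR.
have Cge0 := C0; have rle' := rle.
have eC0 := mulr_ge0 e0 Cge0.
have eC1 : 1000 * e + 72 * (e * C) <= 1 by move: eC; lra.
have sq0 := sqr_ge0 p.
have g0 : 0 <= q + p ^+ 2 by lra.
have [noD|someD] := boolP [&& a != Draw, b != Draw, c != Draw & d != Draw].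
  have /and4P[aD bD cD dD] := noD.
  by rewrite slack_no_draw // !(negbTE aD, negbTE bD, negbTE cD, negbTE dD) /= mulr0n; lra.
have cube : [/\ 0 <= p <= 1, 0 <= q <= 1 & 0 <= r <= 1].
  by split; apply/andP; split => //; lra.
have cert0 : 0 <= jeval p q r (jet_of (certx a b c d)).
  by apply: (jet_nonneg_jeval cube) (cert_nonneg a b c d) => //; lra.
have := jet_of_error cube (certx a b c d).
rewrite ler_norml => /andP[err _].
have cE : peval p q r (certx a b c d) =
    4 * slack p q r a b c d - (b == Draw)%:R * (q + p ^+ 2).
  exact: certE.
(* One factor 3 comes from [p + q + r <= 3 * e], the other from [small], which is at most 11/4 q +
   4/3 p^2 by the bound on r. *)
have eta_le : (p + q + r) * small p q r <= 9 * e * (q + p ^+ 2).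
  have -> : 9 * e * (q + p ^+ 2) = (3 * e) * (3 * (q + p ^+ 2)) by ring.
  by apply: ler_pM; rewrite ?small_ge0 //; rewrite /small; lra.
have errC : pbound (certx a b c d) * ((p + q + r) * small p q r)
    <= C * (9 * e * (q + p ^+ 2)).
  apply: ler_pM; [exact: pbound_ge0| |exact: pboundC|exact: eta_le].
  by rewrite mulr_ge0 ?(small_ge0 cube) //; lra.
(* This requirement is the origin of 72 = 8 * 9 in the choice of [e]. *)
have CR : C * (9 * e) <= 1 / 8 :> R.
  by lra.
have := ler_wpM2r g0 CR.
have nD : 1 <= (a == Draw)%:R + (b == Draw)%:R + (c == Draw)%:R + (d == Draw)%:R :> R.
  rewrite -!natrD ler1n !addn_gt0 !lt0b; move: someD.
  by rewrite !negb_and !negbK !orbA.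
have := ler_wpM2l g0 nD.
lra.
Qed.
End drift_bound.

(** * Averaging the decrease over stationary windows *)

Section total_drift.
Context {R : realType} (C e p q r : R).
Hypothesis C0 : 0 <= C.
Hypothesis pboundC : forall a b c d, pbound (certx a b c d) <= C.
Hypothesis eC : e * (1000 + 72 * C) <= 1.
Hypothesis pqr : [/\ 0 <= p <= e, 0 <= q <= e & 0 <= r <= e].
Hypothesis rle : r <= 7 / 4 * q + 1 / 3 * p ^+ 2.

(** [mu n t] stands for the probability of reading the word [t] on a diagonal at look-ahead [n];
    [mu_cons] and [mu_rcons] together express invariance along the diagonal. *)
Variable mu : nat -> seq status -> R.
Hypothesis mu_ge0 : forall n t, 0 <= mu n t.
Hypothesis mu_nil : forall n, mu n [::] = 1.
Hypothesis mu_cons : forall n t, mu n t = \sum_(a <- statuses) mu n (a :: t).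
Hypothesis mu_rcons : forall n t, mu n t = \sum_(a <- statuses) mu n (rcons t a).
Hypothesis mu_step : forall n a' b' c', mu n.+1 [:: a'; b'; c'] =
  \sum_(a <- statuses) \sum_(b <- statuses) \sum_(c <- statuses)
  \sum_(d <- statuses) mu n [:: a; b; c; d] *
    (transition p q r a b a' * (transition p q r b c b' * transition p q r c d c')).

Notation "\sumst_ a F" := (\sum_(a <- statuses) F)
  (at level 41, a name, F at level 41).

Definition total_potential (n : nat) : R :=
  \sumst_ a \sumst_ b \sumst_ c
    mu n [:: a; b; c] * (potential p q r a b c + potential p q r c b a).

(** The direct half of the potential is placed on the first three sites and the mirrored half on the
    last three. Summing out the fourth site at either end is legitimate by stationarity. *)
Lemma total_potential_now (n : nat) : total_potential n =
  \sumst_ a \sumst_ b \sumst_ c \sumst_ d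
    mu n [:: a; b; c; d] * (potential p q r a b c + potential p q r d c b).
Proof.
transitivity (\sumst_ a \sumst_ b \sumst_ c
     mu n [:: a; b; c] * potential p q r a b c +
   \sumst_ a \sumst_ b \sumst_ c
     mu n [:: a; b; c] * potential p q r c b a).
  rewrite -big_split; apply: eq_bigr => a _.
  rewrite -big_split; apply: eq_bigr => b _.
  by rewrite -big_split; apply: eq_bigr => c _; rewrite mulrDr.
transitivity (\sumst_ a \sumst_ b \sumst_ c \sumst_ d
     mu n [:: a; b; c; d] * potential p q r a b c +
   \sumst_ a \sumst_ b \sumst_ c \sumst_ d
     mu n [:: a; b; c; d] * potential p q r d c b).
  congr (_ + _).
    apply: eq_bigr => a _; apply: eq_bigr => b _; apply: eq_bigr => c _.
    by rewrite mu_rcons mulr_suml.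
  rewrite [RHS]exchange_big; apply: eq_bigr => b _.
  rewrite [RHS]exchange_big; apply: eq_bigr => c _.
  rewrite [RHS]exchange_big; apply: eq_bigr => d _.
  by rewrite mu_cons mulr_suml.
rewrite -big_split; apply: eq_bigr => a _.
rewrite -big_split; apply: eq_bigr => b _.
rewrite -big_split; apply: eq_bigr => c _.
by rewrite -big_split; apply: eq_bigr => d _; rewrite mulrDr.
Qed.

Lemma total_potential_next (n : nat) : total_potential n.+1 =
  \sumst_ a \sumst_ b \sumst_ c \sumst_ d mu n [:: a; b; c; d] *
    \sumst_ a' \sumst_ b' \sumst_ c'
      transition p q r a b a' * (transition p q r b c b' * transition p q r c d c')
      * (potential p q r a' b' c' + potential p q r c' b' a').
Proof.
pose F a b c d a' b' c' := mu n [:: a; b; c; d] *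
   (transition p q r a b a' * (transition p q r b c b' * transition p q r c d c')
      * (potential p q r a' b' c' + potential p q r c' b' a')).
transitivity (\sumst_ a' \sumst_ b' \sumst_ c'
   \sumst_ a \sumst_ b \sumst_ c \sumst_ d F a b c d a' b' c').
  apply: eq_bigr => a' _; apply: eq_bigr => b' _; apply: eq_bigr => c' _.
  rewrite mu_step mulr_suml; apply: eq_bigr => a _.
  rewrite mulr_suml; apply: eq_bigr => b _.
  rewrite mulr_suml; apply: eq_bigr => c _.
  by rewrite mulr_suml; apply: eq_bigr => d _; rewrite /F -mulrA.
have pull (G : status -> status -> status -> status -> status -> R) :
    \sumst_ x \sumst_ a \sumst_ b \sumst_ c \sumst_ d G x a b c d =
    \sumst_ a \sumst_ b \sumst_ c \sumst_ d \sumst_ x G x a b c d.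
  rewrite exchange_big; apply: eq_bigr => a _.
  rewrite exchange_big; apply: eq_bigr => b _.
  rewrite exchange_big; apply: eq_bigr => c _.
  by rewrite exchange_big.
under eq_bigr => a' _ do under eq_bigr => b' _ do rewrite pull.
under eq_bigr => a' _ do rewrite pull.
rewrite pull.
apply: eq_bigr => a _; apply: eq_bigr => b _.
apply: eq_bigr => c _; apply: eq_bigr => d _.
rewrite mulr_sumr; apply: eq_bigr => a' _.
rewrite mulr_sumr; apply: eq_bigr => b' _.
by rewrite mulr_sumr; apply: eq_bigr.
Qed.

Lemma total_potential_drift (n : nat) :
  total_potential n - total_potential n.+1 =
  \sumst_ a \sumst_ b \sumst_ c \sumst_ d
    mu n [:: a; b; c; d] * slack p q r a b c d.
Proof.
rewrite total_potential_now total_potential_next.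
do 4![rewrite -sumrB; apply: eq_bigr => ? _].
by rewrite slackE mulrBr.
Qed.

(** Each site of a window is [Draw] with the same probability ([XD1] to [XD4]), so the four errors
    of one eighth consume half of the gain. The other half, divided by the factor 4 of the
    certificate, is an eighth. *)
Lemma total_potential_decrease (n : nat) :
  1 / 8 * (q + p ^+ 2) * mu n [:: Draw] <= total_potential n - total_potential n.+1.
Proof.
have sel (f : status -> R) : \sumst_ a (a == Draw)%:R * f a = f Draw.
  by rewrite !big_cons big_nil /= !mul0r !add0r mul1r addr0.
pose X a b c d : R := mu n [:: a; b; c; d].
have XD1 : \sumst_ a \sumst_ b \sumst_ c \sumst_ d (a == Draw)%:R * X a b c d
    = mu n [:: Draw].
  transitivity (\sumst_ a (a == Draw)%:R * mu n [:: a]); last by rewrite sel.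
  apply: eq_bigr => a _; rewrite [mu n _]mu_rcons mulr_sumr; apply: eq_bigr => b _.
  rewrite [mu n _]mu_rcons mulr_sumr; apply: eq_bigr => c _.
  by rewrite [mu n _]mu_rcons mulr_sumr; apply: eq_bigr.
have XD2 : \sumst_ a \sumst_ b \sumst_ c \sumst_ d (b == Draw)%:R * X a b c d
    = mu n [:: Draw].
  transitivity (\sumst_ b (b == Draw)%:R * mu n [:: b]); last by rewrite sel.
  rewrite exchange_big.
  apply: eq_bigr => b _; rewrite [mu n _]mu_cons mulr_sumr; apply: eq_bigr => a _.
  rewrite [mu n _]mu_rcons mulr_sumr; apply: eq_bigr => c _.
  by rewrite [mu n _]mu_rcons mulr_sumr; apply: eq_bigr.
have XD3 : \sumst_ a \sumst_ b \sumst_ c \sumst_ d (c == Draw)%:R * X a b c d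
    = mu n [:: Draw].
  transitivity (\sumst_ c (c == Draw)%:R * mu n [:: c]); last by rewrite sel.
  under eq_bigr => a _ do rewrite exchange_big.
  rewrite exchange_big.
  apply: eq_bigr => c _; rewrite [mu n _]mu_cons mulr_sumr exchange_big.
  apply: eq_bigr => b _.
  rewrite [mu n _]mu_cons mulr_sumr; apply: eq_bigr => a _.
  by rewrite [mu n _]mu_rcons mulr_sumr; apply: eq_bigr.
have XD4 : \sumst_ a \sumst_ b \sumst_ c \sumst_ d (d == Draw)%:R * X a b c d
    = mu n [:: Draw].
  transitivity (\sumst_ d (d == Draw)%:R * mu n [:: d]); last by rewrite sel.
  under eq_bigr => a _ do under eq_bigr => b _ do rewrite exchange_big.
  under eq_bigr => a _ do rewrite exchange_big.
  rewrite exchange_big.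
  apply: eq_bigr => d _; rewrite [mu n _]mu_cons mulr_sumr.
  under eq_bigr => a _ do rewrite exchange_big.
  rewrite exchange_big.
  apply: eq_bigr => c _.
  rewrite [mu n _]mu_cons mulr_sumr exchange_big; apply: eq_bigr => b _.
  by rewrite [mu n _]mu_cons mulr_sumr; apply: eq_bigr.
rewrite total_potential_drift.
set g := q + p ^+ 2.
have low : \sumst_ a \sumst_ b \sumst_ c \sumst_ d
      (g * ((b == Draw)%:R * X a b c d)
       - 1 / 8 * g * ((a == Draw)%:R * X a b c d)
       - 1 / 8 * g * ((b == Draw)%:R * X a b c d)
       - 1 / 8 * g * ((c == Draw)%:R * X a b c d)
       - 1 / 8 * g * ((d == Draw)%:R * X a b c d))
   <= 4 * \sumst_ a \sumst_ b \sumst_ c \sumst_ d X a b c d * slack p q r a b c d.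
  rewrite mulr_sumr; apply: ler_sum => a _.
  rewrite mulr_sumr; apply: ler_sum => b _.
  rewrite mulr_sumr; apply: ler_sum => c _.
  rewrite mulr_sumr; apply: ler_sum => d _.
  have := ler_wpM2r (mu_ge0 n [:: a; b; c; d])
    (slack_lower_bound C0 pboundC eC pqr rle a b c d).
  by rewrite -/(X a b c d) -/g; lra.
have : 1 / 2 * g * mu n [:: Draw] <=
    4 * \sumst_ a \sumst_ b \sumst_ c \sumst_ d X a b c d * slack p q r a b c d.
  apply: le_trans low.
  have -> : 1 / 2 * g * mu n [:: Draw] = g * mu n [:: Draw]
     - 1 / 8 * g * mu n [:: Draw] - 1 / 8 * g * mu n [:: Draw]
     - 1 / 8 * g * mu n [:: Draw] - 1 / 8 * g * mu n [:: Draw] by lra.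
  rewrite -{1}XD2 -{1}XD1 -{1}XD2 -{1}XD3 -{1}XD4.
  do 4![rewrite !mulr_sumr -!sumrB; apply: ler_sum => ? _].
  exact: lexx.
lra.
Qed.

Lemma mu_le1 (n : nat) (a b c : status) : mu n [:: a; b; c] <= 1.
Proof.
have le_cons x t : mu n (x :: t) <= mu n t.
  by rewrite (mu_cons n t); apply: (le_sum_status (f := fun x => mu n (x :: t))).
rewrite -(mu_nil n); apply: le_trans (le_cons _ _) _.
by apply: le_trans (le_cons _ _) (le_cons _ _).
Qed.

Lemma sum_draw_bounded : exists B : R, forall N,
  \sum_(n < N) (1 / 8 * (q + p ^+ 2) * mu n [:: Draw]) <= B.
Proof.
pose M := \sumst_ a \sumst_ b \sumst_ c
  `|potential p q r a b c + potential p q r c b a|.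
have bound n : `|total_potential n| <= M.
  do 3![apply: le_trans (ler_norm_sum _ _ _) _; apply: ler_sum => ? _].
  by rewrite normrM (ger0_norm (mu_ge0 _ _)) ler_piMl ?mu_le1.
exists (M + M) => N.
apply: (@le_trans _ _ (total_potential 0 - total_potential N)).
  elim: N => [|N IHN]; first by rewrite big_ord0 subrr.
  rewrite big_ord_recr /=; apply: le_trans (lerD IHN (total_potential_decrease N)) _.
  by rewrite addrA subrK.
by have := bound 0%N; have := bound N; rewrite !ler_norml; lra.
Qed.

End total_drift.

(** * The constraints on p, q, r bound r *)

(** To leading order, (C1) gives p <= q and (C2) gives p <= 2q, whence r <= q and r <= 3/2 q by the
    common constraint. In (C3), p <= q + r and 4r <= p + 4q yield r <= 5/3 q. (C4) directly gives r
    <= 3/2 q + 1/4 p^2. The margin up to 7/4 and 1/3 absorbs the remaining quadratic terms. *)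
Lemma edge_trap_bound {R : realType} (p q r : R) :
  0 <= p <= 1 / 1000 -> 0 <= q <= 1 / 1000 -> 0 <= r <= 1 / 1000 ->
  4 * r + (p + q) ^+ 2
    <= 2 * (p + q) + 6 * r ^+ 2 + 3 * r * (p + 2 * q) ->
  [|| C1 p q r, C2 p q r, C3 p q r | C4 p q r] ->
  r <= 7 / 4 * q + 1 / 3 * p ^+ 2.
Proof.
move=> /andP[p0 p1] /andP[q0 q1] /andP[r0 r1] Hsum HC.
have s0 : 0 <= 1 - p - q by lra.
have rs0 : 0 <= r * (1 - p - q) by rewrite mulr_ge0.
have k1 : 1 - q - r * (1 - p - q) <= 1 by lra.
have rs1 : r * (1 - p - q) <= r by rewrite ler_piMr //; lra.
have k0 : 0 <= q + r * (1 - p - q) by rewrite addr_ge0.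
have le_small (x y : R) : 0 <= x -> y <= 1 / 1000 -> x * y <= 1 / 1000 * x.
  by move=> x0 y1; rewrite [_ * x]mulrC ler_wpM2l.
have rp := le_small r p r0 p1; have rq := le_small r q r0 q1.
have rr := le_small r r r0 r1; have pp := le_small p p p0 p1.
have pr := le_small p r p0 r1; have qp := le_small q p q0 p1.
have pp0 := mulr_ge0 p0 p0; have qq0 := mulr_ge0 q0 q0.
have pq0 := mulr_ge0 p0 q0; have pr0 := mulr_ge0 p0 r0.
have qr0 := mulr_ge0 q0 r0; have rr0 := mulr_ge0 r0 r0.
move: Hsum; rewrite !expr2 => Hsum.
case/or4P: HC => [HC|/andP[_ HC]|/and3P[/andP[_ HC] _ HC']|/andP[_ HC]].
- have : q * (1 - q - r * (1 - p - q)) <= q by rewrite ler_piMr.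
  move: HC; rewrite /C1; lra.
- by move: HC; rewrite !expr2; lra.
- have : (q + r * (1 - p - q)) * (1 - q - r * (1 - p - q)) <= q + r * (1 - p - q).
    by rewrite ler_piMr.
  by move: HC HC'; rewrite !expr2; lra.
- by move: HC; rewrite !expr2; lra.
Qed.

(** * Statuses and winning strategies *)

Section game_value.
Variables (lv : vertex -> vlabel) (le : edge -> elabel).

Fixpoint value (n : nat) (v : vertex) : status :=
  if n is n'.+1 then
    update (lv v) (le (v, false)) (le (v, true))
      (value n' (edge_head (v, false))) (value n' (edge_head (v, true)))
  else Draw.

(** [Draw] means undecided here: [update] is monotone when a decided status is regarded as refining
    [Draw]. *)
Lemma update_stable (l : vlabel) (e e' : elabel) (a b a' b' : status) :
  (a != Draw -> a' = a) -> (b != Draw -> b' = b) ->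
  update l e e' a b != Draw -> update l e e' a' b' = update l e e' a b.
Proof.
by case: l => //; case: e => //; case: e' => //; case: a => [->|->|_] //;
  case: b => [->|->|_] //; case: a' => //; case: b'.
Qed.

Lemma value_succ (n : nat) (v : vertex) : value n v != Draw -> value n.+1 v = value n v.
Proof. by elim: n v => [//|n IHn] v; apply: update_stable; exact: IHn. Qed.

Lemma value_stable (n k : nat) (v : vertex) :
  (n <= k)%N -> value n v != Draw -> value k v = value n v.
Proof.
move=> /subnK <-; elim: (k - n)%N => [//|j IHj] nD.
by rewrite addSn value_succ IHj.
Qed.

Variable v0 : vertex.

Lemma opponentK (i : player) : opponent (opponent i) = i.
Proof. by case: i. Qed.

Lemma mover_succ (n : nat) : mover n.+1 = opponent (mover n).
Proof. by rewrite /mover /=; case: odd. Qed.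

Lemma player_neq (i j : player) : i <> j -> i = opponent j.
Proof. by case: i; case: j. Qed.

(** No edge precedes stage 0: the initial check is an arrival of the second player, that is, of
    [opponent (mover 0)], so [stage_open] covers it too. *)
Definition edge_open_into (m : nat -> bool) (k : nat) : Prop :=
  if k is k'.+1 then le (position v0 m k', m k') = EOpen else True.

Lemma stage_open (m : nat -> bool) (k : nat) : edge_open_into m k ->
  stage lv le v0 m k = arrival lv (opponent (mover k)) (position v0 m k).
Proof. by case: k => [//|k] /= ->; rewrite mover_succ opponentK. Qed.

(* The move to make with [n] more moves to look ahead: towards a lost vertex
   for the opponent when there is one. *)
Definition good_move (n : nat) (v : vertex) : bool :=
  ~~ ((le (v, false) == EOpen) && (value n (edge_head (v, false)) == Loss)).

(** Strategies see only the directions chosen so far; this recovers the position of the token. *)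
Fixpoint walk (v : vertex) (h : seq bool) : vertex :=
  if h is d :: h' then walk (edge_head (v, d)) h' else v.

Lemma walk_rcons (v : vertex) (h : seq bool) (d : bool) :
  walk v (rcons h d) = edge_head (walk v h, d).
Proof. by elim: h v => //= d' h IHh v; rewrite IHh. Qed.

Lemma mkseqS (T : Type) (f : nat -> T) (n : nat) :
  mkseq f n.+1 = rcons (mkseq f n) (f n).
Proof. by rewrite /mkseq -addn1 iotaD map_cat /= add0n cats1. Qed.

Lemma walk_mkseq (m : nat -> bool) (n : nat) :
  walk v0 (mkseq m n) = position v0 m n.
Proof. by elim: n => [//|n IHn]; rewrite mkseqS walk_rcons IHn. Qed.

Lemma update_win (e e' : elabel) (a b : status) :
  update VOpen e e' a b = Win ->
  (e = EOpen /\ a = Loss) \/ (e' = EOpen /\ b = Loss).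
Proof. by case: e; case: e'; case: a; case: b => //= _; auto. Qed.

Lemma update_loss (e e' : elabel) (a b : status) :
  update VOpen e e' a b = Loss ->
  (e = EOpen -> a = Win) /\ (e' = EOpen -> b = Win).
Proof. by case: e; case: e'; case: a; case: b. Qed.

(** Induction on the remaining look-ahead [j] after [k] moves: the token stays on sites of status
    [Win] at the turns of [i] and [Loss] at those of the opponent. At look-ahead 0 every site is
    [Draw], so the game must end before, in favour of [i]. *)
Lemma good_move_wins (n : nat) (i : player) (m : nat -> bool) :
  consistent i (fun h => good_move (n - (size h).+1) (walk v0 h)) m ->
  forall j k, (j + k = n)%N ->
  (forall l, (l < k)%N -> stage lv le v0 m l = None) ->
  edge_open_into m k ->
  (mover k = i /\ value j (position v0 m k) = Win) \/
  (mover k <> i /\ value j (position v0 m k) = Loss) ->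
  wins lv le v0 i m.
Proof.
move=> cons_m; elim=> [|j IHj] k jk noneS open_k; first by case=> -[].
move=> Hk.
have Sk := stage_open open_k.
have step : lv (position v0 m k) = VOpen ->
    le (position v0 m k, m k) = EOpen ->
    (mover k.+1 = i /\ value j (position v0 m k.+1) = Win) \/
    (mover k.+1 <> i /\ value j (position v0 m k.+1) = Loss) ->
    wins lv le v0 i m.
  move=> lvk lek; apply: IHj => //; first by rewrite addnS -addSn.
  move=> l; rewrite ltnS leq_eqVlt => /orP[/eqP ->|]; last exact: noneS.
  by rewrite Sk /arrival lvk.
case lvk: (lv (position v0 m k)) in step Sk Hk *.
- case: Hk => -[mk]; rewrite /= lvk //= => _.
  by exists k; rewrite Sk /arrival lvk opponentK mk.
- case: Hk => -[mk]; rewrite /= lvk //= => _.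
  by exists k; rewrite Sk /arrival lvk (player_neq mk) opponentK.
- case: Hk => -[mk]; rewrite /= lvk.
    move=> /update_win good.
    have mkE : m k = good_move j (position v0 m k).
      by rewrite (cons_m k mk) size_mkseq walk_mkseq -jk addSnnS addnK.
    have [lek valk] : le (position v0 m k, m k) = EOpen /\
        value j (edge_head (position v0 m k, m k)) = Loss.
      rewrite mkE /good_move.
      case: (boolP (_ && _)) => [/andP[/eqP -> /eqP ->] //|/=].
      by case: good => -[-> ->].
    apply: step => //; right; split => //.
    by rewrite mover_succ mk; case: (i).
  move=> /update_loss[good good'].
  case lek: (le (position v0 m k, m k)) in step *.
    exists k.+1; rewrite /= lek (player_neq mk) opponentK; split => // l.
    rewrite ltnS leq_eqVlt => /orP[/eqP ->|]; last exact: noneS.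
    by rewrite Sk /arrival lvk.
  apply: step => //; left; split.
    by rewrite mover_succ (player_neq mk) opponentK.
  by move: lek => /=; case: (m k); [exact: good'|exact: good].
Qed.

Lemma draw_value (n : nat) : is_draw lv le v0 -> value n v0 = Draw.
Proof.
move=> drawn; case valn: (value n v0) => //.
  case: (drawn First); exists (fun h => good_move (n - (size h).+1) (walk v0 h)).
  by move=> m cm; apply: (good_move_wins cm (addn0 n)) => //; left.
case: (drawn Second); exists (fun h => good_move (n - (size h).+1) (walk v0 h)).
by move=> m cm; apply: (good_move_wins cm (addn0 n)) => //; right.
Qed.
Definition never (c : status) (v : vertex) : Prop := forall n, value n v <> c.

Lemma never_win_trap (v : vertex) : never Win v -> lv v <> VTrap.
Proof. by move=> nW lvv; apply: (nW 1%N); rewrite /= lvv. Qed.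

Lemma never_loss_target (v : vertex) : never Loss v -> lv v <> VTarget.
Proof. by move=> nL lvv; apply: (nL 1%N); rewrite /= lvv. Qed.

Lemma never_win_next (v : vertex) (d : bool) :
  lv v = VOpen -> never Win v -> le (v, d) = EOpen -> never Loss (edge_head (v, d)).
Proof.
move=> lvv nW lev n valn; apply: (nW n.+1); rewrite /= lvv.
case: d lev valn => -> -> //=.
by case: (through _ _).
Qed.

(** Otherwise each of the two moves either crosses a trap edge or leads to a site that becomes [Win]
    at some look-ahead. Statuses being stable, both hold at the larger look-ahead, which settles [v]
    as [Loss] one step later. *)
Lemma never_loss_next (v : vertex) : lv v = VOpen -> never Loss v ->
  exists d, le (v, d) = EOpen /\ never Win (edge_head (v, d)).
Proof.
move=> lvv nL; apply: contrapT => none.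
have eventually_win d : exists n, forall k, (n <= k)%N ->
    through (le (v, d)) (value k (edge_head (v, d))) = Win.
  case lev: (le (v, d)); first by exists 0%N.
  have [n valn] : exists n, value n (edge_head (v, d)) = Win.
    apply: contrapT => noW; apply: none; exists d; split=> // n valn.
    by apply: noW; exists n.
  by exists n => k nk; rewrite /= (value_stable nk) valn.
have [n hn] := eventually_win false; have [n' hn'] := eventually_win true.
apply: (nL (maxn n n').+1); rewrite /= lvv.
by rewrite /update hn ?leq_maxl // hn' ?leq_maxr.
Qed.

(** Against an alleged winning strategy of [i], the other player uses [escape], which crosses open
    edges to sites that never become [Win]. Then [i] always moves from such sites and the other
    player from sites that never become [Loss], so no stage declares [i] the winner. *)
Lemma value_draw : (forall n, value n v0 = Draw) -> is_draw lv le v0.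
Proof.
move=> drawn i [s win_s].
pose escape v : bool := if pselect (le (v, true) = EOpen /\
  never Win (edge_head (v, true))) then true else false.
have escapeP v : lv v = VOpen -> never Loss v ->
    le (v, escape v) = EOpen /\ never Win (edge_head (v, escape v)).
  move=> lvv nL; rewrite /escape; case: pselect => //= nt.
  by have [[|] h] := never_loss_next lvv nL; first case: nt.
pose reply h := if pselect (mover (size h) = i) then s h else escape (walk v0 h).
(* The play of [s] against [escape], built together with its finite histories. *)
pose history n := iter n (fun h => rcons h (reply h)) [::].
pose m n := reply (history n).
have mE n : mkseq m n = history n by elim: n => [//|n IHn]; rewrite mkseqS IHn.
have size_h n : size (history n) = n by rewrite -mE size_mkseq.
have cons_m : consistent i s m.
  by move=> n mn; rewrite mE /m /reply size_h; case: pselect.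
have esc_m n : mover n <> i -> m n = escape (position v0 m n).
  by move=> mn; rewrite /m /reply size_h -mE walk_mkseq; case: pselect.
have [n [Sn noneS]] := win_s m cons_m.
have inv k : (k <= n)%N -> edge_open_into m k /\
    (mover k = i -> never Win (position v0 m k)) /\
    (mover k <> i -> never Loss (position v0 m k)).
  elim: k => [|k IHk] kn; first by split=> //; split=> _ j; rewrite drawn.
  have [open_k [winP lossP]] := IHk (ltnW kn).
  have := noneS k kn; rewrite (stage_open open_k) /arrival.
  case lvk: (lv _) => // _.
  have [mk|mk] := pselect (mover k = i).
    (* A trap edge crossed by [i] would end the play in favour of the opponent, at stage [n] or
       earlier. *)
    have lek : le (position v0 m k, m k) = EOpen.
      case lek: (le _) => //.
      have Sk : stage lv le v0 m k.+1 = Some (opponent i) by rewrite /= lek mk.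
      move: kn; rewrite leq_eqVlt => /orP[/eqP kn|kn].
        by move: Sn; rewrite -kn Sk; case: (i).
      by move: (noneS _ kn); rewrite Sk.
    split=> //; split; rewrite mover_succ mk => oi; first by case: (i) oi.
    exact: (never_win_next lvk (winP mk) lek).
  have [lek nW] := escapeP _ lvk (lossP mk).
  rewrite -esc_m // in lek nW.
  split=> //; split=> //; rewrite mover_succ => oi.
  by case: oi; rewrite (player_neq mk) opponentK.
have [open_n [winP lossP]] := inv n (leqnn n).
move: Sn; rewrite (stage_open open_n) /arrival.
have [mn|mn] := pselect (mover n = i).
  have := never_win_trap (winP mn).
  by case: (lv _) => // _ [] oi; move: oi; rewrite mn; case: (i).
have := never_loss_target (lossP mn).
by case: (lv _) => // _ []; rewrite opponentK.
Qed.
End game_value.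

(** * Independence of labels *)

Section real_probability.
Context (d : measure_display) (T : measurableType d) (R : realType).
Variable P : probability T R.

Definition pr (B : set T) : R := fine (P B).

Lemma prE (B : set T) : measurable B -> P B = (pr B)%:E.
Proof. by move=> mB; rewrite /pr fineK // fin_num_measure. Qed.

Lemma pr_ge0 (B : set T) : 0 <= pr B.
Proof. by rewrite /pr fine_ge0. Qed.

Lemma pr_set0 : pr set0 = 0.
Proof. by rewrite /pr measure0. Qed.

Lemma pr_setT : pr setT = 1.
Proof. by rewrite /pr probability_setT. Qed.

Lemma prU (A B : set T) : measurable A -> measurable B -> A `&` B = set0 ->
  pr (A `|` B) = pr A + pr B.
Proof.
move=> mA mB AB; rewrite /pr measureU // fineD //; exact: fin_num_measure.
Qed.

Lemma pr_partition (X : eqType) (s : seq X) (f : T -> X) (B : set T) :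
  uniq s -> (forall w, f w \in s) ->
  (forall x, measurable (f @^-1` [set x])) -> measurable B ->
  pr B = \sum_(x <- s) pr (B `&` f @^-1` [set x]).
Proof.
move=> us fs mf mB.
suff H : forall s' : seq X, uniq s' -> measurable [set w | f w \in s'] /\
    pr (B `&` [set w | f w \in s']) = \sum_(x <- s') pr (B `&` f @^-1` [set x]).
  have [_ <-] := H s us; congr pr.
  by apply/seteqP; split=> [w Bw|w []//]; split=> //=; exact: fs.
elim=> [_|x s' IHs' /= /andP[xs' us']].
  have -> : [set w | f w \in [::]] = set0 by apply/seteqP; split.
  by rewrite setI0 big_nil pr_set0.
have [m's E's] := IHs' us'.
have -> : [set w | f w \in x :: s'] = f @^-1` [set x] `|` [set w | f w \in s'].
  apply/seteqP; split=> w /=; rewrite inE.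
    by case/orP=> [/eqP|]; [left|right].
  by case=> [->|->]; rewrite ?eqxx ?orbT.
split; first exact: measurableU.
rewrite setIUr prU; [|exact: measurableI|exact: measurableI|].
  by rewrite big_cons E's.
apply/seteqP; split=> // w /= [[_ fx] [_]].
by rewrite fx (negbTE xs').
Qed.

End real_probability.

Section label_independence.
Context (d : measure_display) (T : measurableType d) (R : realType).
Variable P : probability T R.
Variables (V : vertex -> {RV P >-> vlabel}) (E : edge -> {RV P >-> elabel}).
Variables p q r : R.
Hypothesis lab : percolation_labels V E p q r.

Local Notation label := (vertex + edge)%type.
Local Notation pr := (pr P).

(** [Q] holds the labels not yet exposed. Testing against finite cylinders over [Q] suffices for
    exposing labels one at a time. *)
Definition independent_of (Q : label -> Prop) (B : set T) : Prop :=
  measurable B /\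
  forall (J : {fset label}) (A : label -> set T),
    (forall i, i \in J -> Q i /\ label_sigma_algebra V E i (A i)) ->
    pr (B `&` \bigcap_(i in [set` J]) A i) = pr B * \prod_(i <- J) pr (A i).

Lemma measurable_label (i : label) (A : set T) :
  label_sigma_algebra V E i A -> measurable A.
Proof. by case: i => i [B mB <-]; apply: measurable_funP. Qed.

Lemma measurable_cylinder (J : {fset label}) (A : label -> set T) :
  (forall i, i \in J -> label_sigma_algebra V E i (A i)) ->
  measurable (\bigcap_(i in [set` J]) A i).
Proof.
move=> hA; apply: fin_bigcap_measurable => [|i iJ]; first exact: finite_fset.
exact: measurable_label (hA i iJ).
Qed.

Lemma independent_set0 (Q : label -> Prop) : independent_of Q set0.
Proof. by split=> // J A _; rewrite set0I pr_set0 mul0r. Qed.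

Lemma independent_setT (Q : label -> Prop) : independent_of Q setT.
Proof.
split=> // J A hA; rewrite setTI pr_setT mul1r.
have hA' i : i \in J -> label_sigma_algebra V E i (A i) by move=> /hA[].
rewrite {1}/pr (labels_independent lab hA').
have -> : (\prod_(i <- J) P (A i) = (\prod_(i <- J) pr (A i))%:E)%E.
  rewrite big_seq [in RHS]big_seq; elim/big_ind2: _ => //.
    by move=> x1 x2 y1 y2 -> ->; rewrite EFinM.
  by move=> i iJ; rewrite prE //; apply: measurable_label (hA' i iJ).
by [].
Qed.

Lemma independent_sub (Q Q' : label -> Prop) (B : set T) :
  (forall i, Q' i -> Q i) -> independent_of Q B -> independent_of Q' B.
Proof.
move=> QQ' [mB HB]; split=> // J A hA; apply: HB => i iJ.
by have [/QQ' Qi hi] := hA i iJ.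
Qed.

Lemma independent_partition (X : eqType) (s : seq X) (f : T -> X)
    (Q : label -> Prop) (B : set T) :
  uniq s -> (forall w, f w \in s) ->
  (forall x, measurable (f @^-1` [set x])) -> measurable B ->
  (forall x, independent_of Q (B `&` f @^-1` [set x])) -> independent_of Q B.
Proof.
move=> us fs mf mB HB; split=> // J A hA.
have mA : measurable (\bigcap_(i in [set` J]) A i).
  by apply: measurable_cylinder => i /hA[].
rewrite (pr_partition P us fs mf mB) (pr_partition P us fs mf);
  last exact: measurableI.
rewrite mulr_suml; apply: eq_bigr => x _.
by rewrite setIAC (HB x).2.
Qed.

(** A cylinder over [Q] without [i], intersected with [A], is again a cylinder over [Q]. The empty
    cylinder gives the product formula. *)
Lemma independent_label (Q : label -> Prop) (B : set T) (i : label) (A : set T) :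
  independent_of Q B -> Q i -> label_sigma_algebra V E i A ->
  independent_of (fun j => Q j /\ j <> i) (B `&` A) /\ pr (B `&` A) = pr B * pr A.
Proof.
move=> [mB HB] Qi hA.
have mA := measurable_label hA.
have add (J : {fset label}) (A' : label -> set T) :
    (forall j, j \in J -> (Q j /\ j <> i) /\ label_sigma_algebra V E j (A' j)) ->
    pr (B `&` A `&` \bigcap_(j in [set` J]) A' j) =
      pr B * (pr A * \prod_(j <- J) pr (A' j)).
  move=> hA'.
  have iJ : i \notin J by apply/negP => /hA'[[_]].
  pose A2 j := if j == i then A else A' j.
  have A2J j : j \in J -> A2 j = A' j.
    by rewrite /A2; case: eqP => // -> iJ'; rewrite iJ' in iJ.
  have A2i : A2 i = A by rewrite /A2 eqxx.
  have := HB (i |` J)%fset A2.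
  rewrite bigcap_fsetU1 big_fsetU1 // A2i setIA => add_i.
  have -> : \bigcap_(j in [set` J]) A' j = \bigcap_(j in [set` J]) A2 j.
    by apply: eq_bigcapr => j jJ; rewrite A2J.
  rewrite add_i; last first.
    move=> j; rewrite in_fset1U => /orP[/eqP ->|jJ]; first by rewrite A2i.
    by have [[Qj _] hj] := hA' j jJ; rewrite A2J.
  by congr (_ * (_ * _)); apply: eq_big_seq => j jJ; rewrite A2J.
have prBA : pr (B `&` A) = pr B * pr A.
  have := add fset0 (fun=> setT); rewrite set_fset0 bigcap_set0 setIT.
  by rewrite big_seq_fset0 mulr1; apply.
split=> //; split; first exact: measurableI.
by move=> J A' hA'; rewrite add // prBA mulrA.
Qed.

(** The update of a site reads its vertex label and its two outgoing edges, so every label belongs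
    to exactly one site. *)
Definition tail (i : label) : vertex :=
  match i with inl v => v | inr e => e.1 end.

Lemma label_vertex (v : vertex) (l : vlabel) :
  label_sigma_algebra V E (inl v) (V v @^-1` [set l]).
Proof. by exists [set l]; rewrite ?setTI. Qed.

Lemma label_edge (e : edge) (l : elabel) :
  label_sigma_algebra V E (inr e) (E e @^-1` [set l]).
Proof. by exists [set l]; rewrite ?setTI. Qed.

Lemma pr_vertex (v : vertex) (l : vlabel) :
  pr (V v @^-1` [set l]) = peval p q r (vweight l).
Proof.
rewrite /pr; case: l; rewrite ?(vertex_trap lab) ?(vertex_target lab) //.
by rewrite (vertex_open lab) /=; ring.
Qed.

Lemma pr_edge (e : edge) (l : elabel) :
  pr (E e @^-1` [set l]) = peval p q r (eweight l).
Proof.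
rewrite /pr; case: l; rewrite ?(edge_trap lab) //.
by rewrite (edge_open lab) /=; ring.
Qed.

Definition update_event (v : vertex) (a b c : status) : set T :=
  [set w | update (V v w) (E (v, false) w) (E (v, true) w) a b = c].

Lemma labels_all (x : vlabel * elabel * elabel) : x \in labels.
Proof. by case: x => -[[] []] []. Qed.

Lemma labels_uniq : uniq labels.
Proof. by []. Qed.

Definition site_labels (v : vertex) (w : T) : vlabel * elabel * elabel :=
  (V v w, E (v, false) w, E (v, true) w).

Lemma site_labelsE (v : vertex) (x : vlabel * elabel * elabel) :
  site_labels v @^-1` [set x] =
  V v @^-1` [set x.1.1] `&` E (v, false) @^-1` [set x.1.2]
    `&` E (v, true) @^-1` [set x.2].
Proof.
case: x => -[l e] e'; apply/seteqP; split=> w /=; first by case=> -> -> ->.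
by rewrite /site_labels => -[[-> ->] ->].
Qed.

Lemma measurable_site_labels (v : vertex) (x : vlabel * elabel * elabel) :
  measurable (site_labels v @^-1` [set x]).
Proof.
rewrite site_labelsE; apply: measurableI; first apply: measurableI.
- exact: measurable_label (label_vertex _ _).
- exact: measurable_label (label_edge _ _).
- exact: measurable_label (label_edge _ _).
Qed.

Lemma independent_site_labels (Q : label -> Prop) (B : set T) (v : vertex)
    (x : vlabel * elabel * elabel) :
  independent_of Q B -> (forall i, tail i = v -> Q i) ->
  independent_of (fun i => Q i /\ tail i <> v) (B `&` site_labels v @^-1` [set x]) /\
  pr (B `&` site_labels v @^-1` [set x]) = pr B *
    (peval p q r (vweight x.1.1)
      * (peval p q r (eweight x.1.2) * peval p q r (eweight x.2))).
Proof.
move=> HB Qv; rewrite site_labelsE !setIA.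
have [H1 E1] := independent_label HB (Qv (inl v) erefl) (label_vertex v x.1.1).
have [|H2 E2] := independent_label H1 _ (label_edge (v, false) x.1.2).
  by split=> //; exact: Qv.
have [|H3 E3] := independent_label H2 _ (label_edge (v, true) x.2).
  by split; [split=> //; exact: Qv|case].
split.
  apply: independent_sub H3 => i [Qi tiv].
  by split; [split; [split=> //|]|] => iE; apply: tiv; rewrite iE.
by rewrite E3 E2 E1 !pr_vertex !pr_edge !mulrA.
Qed.

Lemma measurable_update_event (v : vertex) (a b c : status) :
  measurable (update_event v a b c).
Proof.
have -> : update_event v a b c = \bigcup_(x in [set x | x \in labels /\
    update x.1.1 x.1.2 x.2 a b = c]) (site_labels v @^-1` [set x]).
  apply/seteqP; split=> w /=.
    by move=> wc; exists (site_labels v w) => //=; rewrite labels_all.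
  by case=> x /= [_ xc] sx; rewrite /update_event /= -xc -sx.
apply: fin_bigcup_measurable => [|x _]; last exact: measurable_site_labels.
apply: (sub_finite_set _ (finite_seq labels)) => x /= [].
by [].
Qed.

(** Split along the twelve label triples at [v]: on each of them the update is deterministic. *)
Lemma independent_update (Q : label -> Prop) (B : set T) (v : vertex)
    (a b c : status) :
  independent_of Q B -> (forall i, tail i = v -> Q i) ->
  independent_of (fun i => Q i /\ tail i <> v) (B `&` update_event v a b c) /\
  pr (B `&` update_event v a b c) = pr B * transition p q r a b c.
Proof.
move=> HB Qv.
have mBC : measurable (B `&` update_event v a b c).
  by apply: measurableI; [exact: HB.1|exact: measurable_update_event].
have atom x : B `&` update_event v a b c `&` site_labels v @^-1` [set x] =
    if update x.1.1 x.1.2 x.2 a b == c then B `&` site_labels v @^-1` [set x]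
    else set0.
  case: eqP => xc; apply/seteqP; split=> w //=.
  - by case=> -[].
  - by case=> Bw wx; split=> //; split=> //; rewrite /update_event /= -xc -wx.
  - by case=> -[_ wc] wx; apply: xc; rewrite -wc -wx.
split.
  apply: (independent_partition labels_uniq (fun w => labels_all (site_labels v w))
    (measurable_site_labels v) mBC) => x.
  rewrite atom; case: ifP => _; last exact: independent_set0.
  by have [] := independent_site_labels x HB Qv.
rewrite (pr_partition P labels_uniq (fun w => labels_all (site_labels v w))
    (measurable_site_labels v) mBC).
rewrite transitionE [in RHS]big_mkcond mulr_sumr; apply: eq_bigr => x _.
rewrite atom; case: ifP => _; last by rewrite pr_set0 mulr0.
by have [] := independent_site_labels x HB Qv.
Qed.
End label_independence.

(** * Statuses along a diagonal *)

Definition right_of (v : vertex) : vertex := edge_head (v, false).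
(** Words are read along a diagonal towards the upper left, so that the two successors of a site are
    consecutive on the next diagonal. *)
Definition up_left (v : vertex) : vertex := (v.1 - 1, v.2 + 1).

Lemma up_left_right (v : vertex) : up_left (right_of v) = edge_head (v, true).
Proof. by case: v => x y; rewrite /up_left /right_of /= addrK. Qed.

Lemma right_up_left (v : vertex) : right_of (up_left v) = up_left (right_of v).
Proof. by case: v => x y; rewrite /up_left /right_of /= subrK addrK. Qed.

Definition words (k : nat) : seq (seq status) :=
  iter k (fun s => [seq a :: t | a <- statuses, t <- s]) [:: [::]].

Lemma wordsS (k : nat) :
  words k.+1 = [seq a :: t | a <- statuses, t <- words k].
Proof. by []. Qed.

Lemma mem_statuses (a : status) : a \in statuses.
Proof. by case: a. Qed.

Lemma mem_words (t : seq status) : t \in words (size t).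
Proof.
elim: t => [//|a t IHt]; rewrite [size _]/= wordsS.
by apply/allpairsPdep; exists a, t; rewrite mem_statuses.
Qed.

Lemma size_words (k : nat) (t : seq status) : t \in words k -> size t = k.
Proof.
elim: k t => [|k IHk] t; first by rewrite inE => /eqP ->.
rewrite wordsS.
by move=> /allpairsPdep[a [u [_ /IHk <- ->]]].
Qed.

Lemma uniq_words (k : nat) : uniq (words k).
Proof.
elim: k => [//|k IHk]; rewrite wordsS.
by apply: allpairs_uniq_dep => // -[a t] [b u] _ _ /= [-> ->].
Qed.

Lemma sum_wordsS {R : realType} (k : nat) (F : seq status -> R) :
  \sum_(t <- words k.+1) F t =
  \sum_(a <- statuses) \sum_(t <- words k) F (a :: t).
Proof. by rewrite wordsS big_allpairs_dep. Qed.

Lemma sum_words0 {R : realType} (F : seq status -> R) :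
  \sum_(t <- words 0) F t = F [::].
Proof. by rewrite big_seq1. Qed.

Section diagonal.
Variables (lv : vertex -> vlabel) (le : edge -> elabel).

Fixpoint diagonal (n : nat) (v : vertex) (k : nat) : seq status :=
  if k is k'.+1 then value lv le n v :: diagonal n (up_left v) k' else [::].

Fixpoint updates (v : vertex) (u t : seq status) {struct t} : bool :=
  match t, u with
  | c :: t', a :: ((b :: _) as u') =>
      (update (lv v) (le (v, false)) (le (v, true)) a b == c)
      && updates (up_left v) u' t'
  | [::], _ => true
  | _, _ => false
  end.

Lemma size_diagonal (n : nat) (v : vertex) (k : nat) : size (diagonal n v k) = k.
Proof. by elim: k v => //= k IHk v; rewrite IHk. Qed.

Lemma diagonal_in_words (n : nat) (v : vertex) (k : nat) :
  diagonal n v k \in words k.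
Proof. by rewrite -[X in words X](size_diagonal n v) mem_words. Qed.

Lemma diagonal_updates (n : nat) (v : vertex) (t : seq status) :
  (diagonal n.+1 v (size t) == t) =
  updates v (diagonal n (right_of v) (size t).+1) t.
Proof.
elim: t v => [//|c t IHt] v.
rewrite [LHS]/= [RHS]/= eqseq_cons up_left_right; congr (_ && _).
by rewrite -/(diagonal _ _ _) IHt right_up_left up_left_right.
Qed.

Lemma diagonal_rcons (n : nat) (v : vertex) (k : nat) :
  diagonal n v k.+1 =
  rcons (diagonal n v k) (value lv le n (iter k up_left v)).
Proof.
elim: k v => [//|k IHk] v.
by rewrite [LHS]/= -/(diagonal n (up_left v) k.+1) IHk /= -iterSr.
Qed.
End diagonal.

(** * Evolution of word probabilities *)

Section word_probability.
Context (d : measure_display) (T : measurableType d) (R : realType).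
Variable P : probability T R.
Variables (V : vertex -> {RV P >-> vlabel}) (E : edge -> {RV P >-> elabel}).
Variables p q r : R.
Hypothesis lab : percolation_labels V E p q r.

Local Notation label := (vertex + edge)%type.
Local Notation pr := (pr P).
Local Notation independent_of := (independent_of V E).

Definition level (v : vertex) : int := v.1 + v.2.

(* The labels still unexposed once those of the diagonals beyond [v] and of the
   sites to the right of [v] on its own diagonal have been exposed. *)
Definition after (v : vertex) (i : label) : Prop :=
  level (tail i) < level v \/
  (level (tail i) = level v /\ (tail i).1 <= v.1).

Fixpoint transitions (u t : seq status) {struct t} : R :=
  match t, u with
  | c :: t', a :: ((b :: _) as u') =>
      transition p q r a b c * transitions u' t'
  | [::], _ => 1
  | _, _ => 0
  end.

Definition updates_event (v : vertex) (u t : seq status) : set T :=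
  [set w | updates (fun v => V v w) (fun e => E e w) v u t].

(** The sites of the word are treated from right to left. Each exposes only its own labels, so the
    transition probabilities multiply. *)
Lemma independent_updates (u t : seq status) (v : vertex) (B : set T) :
  independent_of (after v) B -> size u = (size t).+1 ->
  independent_of (fun i => level (tail i) < level v) (B `&` updates_event v u t)
  /\ pr (B `&` updates_event v u t) = pr B * transitions u t.
Proof.
elim: t u v B => [|c t IHt] u v B HB.
  move=> _; have -> : updates_event v u [::] = setT by apply/seteqP; split.
  rewrite setIT /= mulr1; split=> //.
  by apply: independent_sub HB => i; left.
case: u => [//|a [//|b u]] [su].
have [|H1 E1] := independent_update lab (Q := after v) (v := v) a b c HB.
  by move=> i ti; right; rewrite ti.
have H2 : independent_of (after (up_left v)) (B `&` update_event V E v a b c).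
  apply: independent_sub H1 => i; rewrite /after /level.
  case: (tail i) => x y; case: v {HB E1} => x' y' /= h.
  by split; [lia|move=> [xx yy]; lia].
have [H3 E3] := IHt (b :: u) (up_left v) _ H2 (congr1 succn su).
have -> : B `&` updates_event v [:: a, b & u] (c :: t) =
    B `&` update_event V E v a b c `&` updates_event (up_left v) (b :: u) t.
  apply/seteqP; split=> w /=.
    by case=> Bw /andP[/eqP wc wt].
  by case=> -[Bw /eqP wc] wt; split=> //; apply/andP.
split; last by rewrite E3 E1 mulrA.
apply: independent_sub H3 => i; rewrite /level.
by case: v {HB H1 E1 H2 E3} => x y /=; lia.
Qed.

Definition word_event (n : nat) (v : vertex) (t : seq status) : set T :=
  [set w | diagonal (fun v => V v w) (fun e => E e w) n v (size t) = t].

Definition word_pr (n : nat) (v : vertex) (t : seq status) : R :=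
  pr (word_event n v t).

Lemma word_eventE (n : nat) (v : vertex) (k : nat) (t : seq status) :
  size t = k -> word_event n v t =
  (fun w => diagonal (fun v => V v w) (fun e => E e w) n v k) @^-1` [set t].
Proof. by move=> <-. Qed.

Lemma preimage_diagonal (n : nat) (v : vertex) (k : nat) (t : seq status) :
  (fun w => diagonal (fun v => V v w) (fun e => E e w) n v k) @^-1` [set t] =
  if size t == k then word_event n v t else set0.
Proof.
case: eqP => tk; first by rewrite (word_eventE _ _ tk).
by apply/seteqP; split=> // w /= wt; apply: tk; rewrite -wt size_diagonal.
Qed.

Lemma word_event_step (n : nat) (v : vertex) (t u : seq status) :
  size u = (size t).+1 ->
  word_event n.+1 v t `&` word_event n (right_of v) u =
  word_event n (right_of v) u `&` updates_event v u t.
Proof.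
move=> su; apply/seteqP; split=> w [].
  move=> wt wu; split=> //; rewrite /updates_event /= -{1}wu su -diagonal_updates.
  exact/eqP.
move=> wu ut; split=> //.
by apply/eqP; rewrite diagonal_updates -su wu.
Qed.

(** Statuses on a diagonal depend only on labels of that diagonal and of those beyond it. The
    induction splits over the words on the next diagonal; it also yields measurability, which
    [independent_of] includes. *)
Lemma word_independent (n : nat) (v : vertex) (t : seq status) :
  independent_of (fun i => level (tail i) < level v) (word_event n v t).
Proof.
elim: n v t => [|n IHn] v t.
  have [tD|tD] := pselect (t = nseq (size t) Draw).
    have -> : word_event 0 v t = setT; last exact: independent_setT lab _.
    apply/seteqP; split=> // w _; rewrite /word_event /= [RHS]tD.
    by elim: (size t) v => //= k IHk v; rewrite IHk.
  have -> : word_event 0 v t = set0; last exact: independent_set0.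
  apply/seteqP; split=> // w wt; apply: tD; rewrite -[LHS]wt.
  by elim: (size t) v {wt} => //= k IHk v; rewrite IHk.
have meas k u : measurable ((fun w =>
    diagonal (fun v => V v w) (fun e => E e w) n (right_of v) k) @^-1` [set u]).
  rewrite preimage_diagonal; case: ifP => _ //; exact: (IHn _ _).1.
have Hu u : size u = (size t).+1 ->
    independent_of (after v) (word_event n (right_of v) u).
  move=> su; apply: independent_sub (IHn (right_of v) u) => i.
  by rewrite /after /level; case: v {meas} => x y /=; lia.
have mt : measurable (word_event n.+1 v t).
  have -> : word_event n.+1 v t = \bigcup_(u in [set` words (size t).+1])
      (word_event n (right_of v) u `&` updates_event v u t).
    apply/seteqP; split=> w.
      move=> wt; exists (diagonal (fun v => V v w) (fun e => E e w) n
        (right_of v) (size t).+1).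
        exact: diagonal_in_words.
      rewrite -word_event_step ?size_diagonal //; split=> //.
      by rewrite /word_event /= size_diagonal.
    by case=> u uw; have su := size_words uw; rewrite -word_event_step // => -[].
  apply: fin_bigcup_measurable => [|u uw]; first exact: finite_seq.
  have su := size_words uw.
  by have [[]] := independent_updates (Hu u su) su.
apply: (independent_partition (uniq_words (size t).+1) _ (meas (size t).+1) mt).
  by move=> w; exact: diagonal_in_words.
move=> u; rewrite preimage_diagonal; case: eqP => su; last first.
  by rewrite setI0; exact: independent_set0.
by rewrite word_event_step //; have [] := independent_updates (Hu u su) su.
Qed.

Lemma measurable_word_event (n : nat) (v : vertex) (t : seq status) :
  measurable (word_event n v t).
Proof. by have [] := word_independent n v t. Qed.

Lemma measurable_diagonal (n : nat) (v : vertex) (k : nat) (u : seq status) :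
  measurable ((fun w =>
    diagonal (fun v => V v w) (fun e => E e w) n v k) @^-1` [set u]).
Proof.
by rewrite preimage_diagonal; case: ifP => _ //; exact: measurable_word_event.
Qed.

Lemma word_pr_succ (n : nat) (v : vertex) (t : seq status) :
  word_pr n.+1 v t =
  \sum_(u <- words (size t).+1) word_pr n (right_of v) u * transitions u t.
Proof.
rewrite {1}/word_pr (pr_partition P (uniq_words (size t).+1)
  (fun w => diagonal_in_words _ _ n (right_of v) (size t).+1)
  (measurable_diagonal n (right_of v) (size t).+1) (measurable_word_event n.+1 v t)).
apply: eq_big_seq => u /size_words su.
rewrite preimage_diagonal su eqxx word_event_step //.
have [|_ ->] // := independent_updates (v := v) (B := word_event n (right_of v) u) _ su.
apply: independent_sub (word_independent n (right_of v) u) => i.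
by rewrite /after /level; case: v => x y /=; lia.
Qed.

(** Translation invariance follows from the recursion [word_pr_succ], whose coefficients do not
    depend on the site; at look-ahead 0 every site is [Draw]. *)
Lemma word_pr_shift (n : nat) (v v' : vertex) (t : seq status) :
  word_pr n v t = word_pr n v' t.
Proof.
elim: n v v' t => [|n IHn] v v' t.
  congr pr; apply/seteqP; rewrite /word_event; split=> w /= <-;
    rewrite size_diagonal; elim: (size t) v v' => //= k IHk v v';
    by rewrite (IHk (up_left v) (up_left v')).
by rewrite !word_pr_succ; apply: eq_bigr => u _; rewrite (IHn _ (right_of v')).
Qed.

Lemma word_pr_nil (n : nat) (v : vertex) : word_pr n v [::] = 1.
Proof.
rewrite /word_pr; have -> : word_event n v [::] = setT by apply/seteqP; split.
exact: pr_setT.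
Qed.

Lemma measurable_value (n : nat) (v : vertex) (a : status) :
  measurable ((fun w => value (fun v => V v w) (fun e => E e w) n v) @^-1` [set a]).
Proof.
have -> : (fun w => value (fun v => V v w) (fun e => E e w) n v) @^-1` [set a]
    = word_event n v [:: a].
  by apply/seteqP; split=> w; rewrite /word_event /=; [move=> ->|case].
exact: measurable_word_event.
Qed.

Lemma word_pr_rcons (n : nat) (v : vertex) (t : seq status) :
  word_pr n v t = \sum_(a <- statuses) word_pr n v (rcons t a).
Proof.
rewrite {1}/word_pr (pr_partition P (s := statuses)
  (f := fun w => value (fun v => V v w) (fun e => E e w) n (iter (size t) up_left v)));
  [|by []|by move=> w; exact: mem_statuses|exact: measurable_value
   |exact: measurable_word_event].
apply: eq_bigr => a _; congr pr; apply/seteqP.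
rewrite /word_event; split=> w /=; rewrite size_rcons diagonal_rcons.
  by case=> -> ->.
by move=> /rcons_inj[-> ->].
Qed.

Lemma word_pr_cons (n : nat) (v : vertex) (t : seq status) :
  word_pr n v t = \sum_(a <- statuses) word_pr n v (a :: t).
Proof.
(* Once a letter is prepended at [v], the word [t] begins at [up_left v]. *)
rewrite (word_pr_shift n v (up_left v)).
rewrite {1}/word_pr (pr_partition P (s := statuses)
  (f := fun w => value (fun v => V v w) (fun e => E e w) n v));
  [|by []|by move=> w; exact: mem_statuses|exact: measurable_value
   |exact: measurable_word_event].
apply: eq_bigr => a _; congr pr; apply/seteqP.
rewrite /word_event; split=> w /=; first by case=> -> ->.
by move=> [-> ->].
Qed.

Lemma word_pr_step3 (n : nat) (v : vertex) (a' b' c' : status) :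
  word_pr n.+1 v [:: a'; b'; c'] =
  \sum_(a <- statuses) \sum_(b <- statuses) \sum_(c <- statuses)
  \sum_(d <- statuses) word_pr n v [:: a; b; c; d] *
    (transition p q r a b a' * (transition p q r b c b' * transition p q r c d c')).
Proof.
rewrite word_pr_succ sum_wordsS; apply: eq_bigr => a _.
rewrite sum_wordsS; apply: eq_bigr => b _.
rewrite sum_wordsS; apply: eq_bigr => c _.
rewrite sum_wordsS; apply: eq_bigr => e _.
by rewrite sum_words0 (word_pr_shift n _ v) /= mulr1.
Qed.

(** Replaces a quantification over strategies by countably many word events, which gives both the
    measurability of the draw event and upper bounds on its probability. *)
Lemma draw_eventE (v : vertex) : draw_event V E v = \bigcap_n word_event n v [:: Draw].
Proof.
apply/seteqP; split=> w /=.
  by move=> drawn n _; rewrite /word_event /= (draw_value n drawn).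
by move=> drawn; apply: value_draw => n; have [] := drawn n I.
Qed.

End word_probability.

(** * Conclusion *)

Lemma le0_of_bounded_multiples {R : realType} (x B : R) :
  (forall N : nat, N%:R * x <= B) -> x <= 0.
Proof.
move=> xB; rewrite leNgt; apply/negP => x0.
have := archi_boundP (normr_ge0 (B / x)).
set N := Num.bound _ => BN.
have := le_lt_trans (ler_norm _) BN.
by rewrite ltr_pdivrMr // ltNge xB.
Qed.

Theorem theorem1 (R : realType) :
  exists e1 e2 e3 : R,
    [/\ 0 < e1 < 1, 0 < e2 < 1 & 0 < e3 < 1] /\
    forall p q r : R,
      Theta p q r ->
      p <= e1 -> q <= e2 -> r <= e3 ->
      4 * r + (p + q) ^+ 2
        <= 2 * (p + q) + 6 * r ^+ 2 + 3 * r * (p + 2 * q) ->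
      count id [:: C1 p q r; C2 p q r; C3 p q r; C4 p q r] = 1%N ->
      forall (d : measure_display) (T : measurableType d)
        (P : probability T R)
        (V : vertex -> {RV P >-> vlabel}) (E : edge -> {RV P >-> elabel}),
        percolation_labels V E p q r ->
        forall v0 : vertex, P (draw_event V E v0) = 0%:E.
Proof.
have [C [C0 pboundC]] := @cert_bound R.
(* One threshold serves p, q and r: the 1000 keeps them below 1/1000, and [72 * C] controls the
   truncation errors. *)
have [e [e0 eC]] : exists e : R, 0 < e /\ e * (1000 + 72 * C) = 1.
  have: 0 < 1000 + 72 * C by lra.
  move: (_ + _) => D D0; exists D^-1.
  by rewrite invr_gt0; split=> //; apply: mulVf; rewrite gt_eqF.
have e1 : e <= 1 / 1000.
  by have := mulr_ge0 (ltW e0) C0; lra.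
have e01 : 0 < e < 1 by apply/andP; split; lra.
exists e, e, e; split=> // p q r.
move=> /and5P[/andP[p0 _] /andP[q0 _] /andP[r0 _] pqr0 _] pe qe re Hsum Hcount.
move=> d T P V E lab v0.
have C1234 : [|| C1 p q r, C2 p q r, C3 p q r | C4 p q r].
  by move: Hcount; do 4!case: (_ p q r).
have rle : r <= 7 / 4 * q + 1 / 3 * p ^+ 2.
  by apply: edge_trap_bound Hsum C1234; apply/andP; split=> //; lra.
(* If q + p^2 vanished, so would p and q, and then r by its upper bound, against p + q + r > 0. *)
have gain0 : 0 < q + p ^+ 2.
  have pp0 := sqr_ge0 p.
  rewrite lt_neqAle addr_ge0 // andbT eq_sym paddr_eq0 // sqrf_eq0.
  by apply/negP => /andP[/eqP qE /eqP pE]; move: rle pqr0; rewrite qE pE; lra.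
have [B sumB] : exists B : R, forall N,
    \sum_(n < N) (1 / 8 * (q + p ^+ 2) * word_pr V E n v0 [:: Draw]) <= B.
  have eC1 : e * (1000 + 72 * C) <= 1 by rewrite eC.
  have pqr_e : [/\ 0 <= p <= e, 0 <= q <= e & 0 <= r <= e].
    by rewrite p0 q0 r0 pe qe re.
  apply: (@sum_draw_bounded R C e p q r C0 pboundC eC1 pqr_e rle
    (fun n => word_pr V E n v0)).
  - by move=> n t; exact: pr_ge0.
  - by move=> n; exact: word_pr_nil.
  - by move=> n t; exact: (word_pr_cons lab).
  - by move=> n t; exact: (word_pr_rcons lab).
  - by move=> n a b c; exact: (word_pr_step3 lab).
have mdraw : measurable (draw_event V E v0).
  rewrite draw_eventE; apply: bigcapT_measurable => n.
  exact: measurable_word_event lab _ _ _.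
rewrite prE //; congr EFin; apply/eqP; rewrite eq_le pr_ge0 andbT.
have le_draw n : pr P (draw_event V E v0) <= word_pr V E n v0 [:: Draw].
  rewrite -lee_fin -prE // /word_pr -prE; last exact: measurable_word_event lab _ _ _.
  apply: le_measure; rewrite ?inE //; first exact: measurable_word_event lab _ _ _.
  by rewrite draw_eventE; exact: bigcap_inf.
(* The draw probability, times this positive constant, is below every term of a series with bounded
   partial sums. *)
rewrite -(pmulr_rle0 _ (_ : 0 < 1 / 8 * (q + p ^+ 2))); last by lra.
apply: (@le0_of_bounded_multiples _ _ B) => N.
apply: le_trans (sumB N).
rewrite mulr_natl -[N in _ *+ N]card_ord -sumr_const; apply: ler_sum => n _.
by rewrite ler_pM2l //; lra.
Qed.
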